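(* Let $\mathcal{M}$ be a type ${\rm II}_1$ factor acting on a Hilbert space $\mathcal{H}$ and let $S,T\in \mathcal{M}$. Then $Lat_{\mathcal{M}}\, ST$ is not trivial if and only if $Lat_{\mathcal{M}}\, TS$ is not trivial. Furthermore, if $N(S)=N(T)=0$, then $Lat_{\mathcal{M}}\, ST$ is isomorphic to $Lat_{\mathcal{M}}\, TS$ as lattices, and the lattice of hyperinvariant subspaces of $ST$ is isomorphic to the lattice of hyperinvariant subspaces of $TS$ as lattices.
   Context: For $A\in\mathcal{M}$, $Lat_{\mathcal{M}}\,A$ denotes the lattice of projections $P\in\mathcal{M}$ such that $AP=PAP$; it is trivial if it equals $\{0,I\}$. $N(A)$ denotes the kernel of $A$. A hyperinvariant subspace of $A$ is a closed subspace of $\mathcal{H}$ invariant under every operator in $\{A\}'=\{B\in\mathcal{B}(\mathcal{H}): AB=BA\}$. *)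

(* Defs.v *)
From HB Require Import structures.
From mathcomp Require Import all_boot all_order all_algebra.
From mathcomp Require Import sesquilinear.
From mathcomp Require Import complex.
From mathcomp Require Import all_classical all_reals all_analysis.
Set Implicit Arguments.
Unset Strict Implicit.
Unset Printing Implicit Defensive.
Import Order.TTheory GRing.Theory Num.Theory Num.Def.
Import numFieldNormedType.Exports.

Local Open Scope classical_set_scope.
Local Open Scope ring_scope.

(* The inner product is linear in its first argument and conjugate-linear in
   the second one. *)
Structure hilbert (R : realType) := Hilbert {
  hilbert_sort :> completeNormedModType R[i];
  inner : {dot hilbert_sort for (@conjC R[i])};
  inner_norm : forall x : hilbert_sort, inner x x = `|x| ^+ 2
}.

Definition bounded_op (R : realType) (H : hilbert R) : set (H -> H) :=
  [set A | linear A /\ continuous A].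

Definition is_adjoint (R : realType) (H : hilbert R) (A B : H -> H) : Prop :=
  forall x y : H, inner H (A x) y = inner H x (B y).

Definition commutant (R : realType) (H : hilbert R) (X : set (H -> H)) :
    set (H -> H) :=
  [set B | bounded_op B /\ forall A, X A -> A \o B = B \o A].

Definition von_neumann_algebra (R : realType) (H : hilbert R)
    (M : set (H -> H)) : Prop :=
  [/\ M `<=` @bounded_op R H,
      forall A, M A -> exists2 B, M B & is_adjoint A B
    & commutant (commutant M) = M].

Definition factor (R : realType) (H : hilbert R) (M : set (H -> H)) : Prop :=
  [/\ von_neumann_algebra M,
      exists x : H, x != 0
    & M `&` commutant M = [set A | exists c : R[i], A = fun x => c *: x]].

Definition projection (R : realType) (H : hilbert R) (P : H -> H) : Prop :=
  [/\ bounded_op P, P \o P = P & is_adjoint P P].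

Definition proj_in (R : realType) (H : hilbert R) (M : set (H -> H)) :
    set (H -> H) :=
  [set P | M P /\ projection P].

Definition proj_le (R : realType) (H : hilbert R) (P Q : H -> H) : Prop :=
  range P `<=` range Q.

(* Murray-von Neumann equivalence: V^* V = P and V V^* = Q for some V in M,
   where W plays the role of V^*. *)
Definition mvn_equiv (R : realType) (H : hilbert R) (M : set (H -> H))
    (P Q : H -> H) : Prop :=
  exists V W : H -> H,
    [/\ M V, M W, is_adjoint V W, W \o V = P & V \o W = Q].

Definition finite_proj (R : realType) (H : hilbert R) (M : set (H -> H))
    (P : H -> H) : Prop :=
  proj_in M P /\
  forall Q, proj_in M Q -> proj_le Q P -> mvn_equiv M P Q -> Q = P.

Definition minimal_proj (R : realType) (H : hilbert R) (M : set (H -> H))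
    (P : H -> H) : Prop :=
  [/\ proj_in M P, P <> (fun=> 0)
    & forall Q, proj_in M Q -> proj_le Q P -> Q = (fun=> 0) \/ Q = P].

Definition type_II1_factor (R : realType) (H : hilbert R)
    (M : set (H -> H)) : Prop :=
  [/\ factor M, finite_proj M id & forall P, ~ minimal_proj M P].

Definition null_space (R : realType) (H : hilbert R) (A : H -> H) : set H :=
  [set x | A x = 0].

Definition lat (R : realType) (H : hilbert R) (M : set (H -> H))
    (A : H -> H) : set (H -> H) :=
  [set P | proj_in M P /\ A \o P = P \o A \o P].

Definition trivial_lat (R : realType) (H : hilbert R) (L : set (H -> H)) :
    Prop :=
  L = [set (fun=> 0); id].

Definition subspace_meet (R : realType) (H : hilbert R) (E F : set H) : set H :=
  E `&` F.

Definition subspace_join (R : realType) (H : hilbert R) (E F : set H) : set H :=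
  closure [set x + y | x in E & y in F].

(* The orthogonal projection with range E; it exists as soon as E is a closed
   subspace (the default value is irrelevant in that case). *)
Definition proj_onto (R : realType) (H : hilbert R) (E : set H) : H -> H :=
  xget (fun=> 0) [set P : H -> H | projection P /\ range P = E].

Definition proj_meet (R : realType) (H : hilbert R) (P Q : H -> H) : H -> H :=
  proj_onto (subspace_meet (range P) (range Q)).

Definition proj_join (R : realType) (H : hilbert R) (P Q : H -> H) : H -> H :=
  proj_onto (subspace_join (range P) (range Q)).

Definition closed_subspace (R : realType) (H : hilbert R) (E : set H) : Prop :=
  [/\ closed E, E 0 & forall (c : R[i]) x y, E x -> E y -> E (c *: x + y)].

Definition hyperinvariant (R : realType) (H : hilbert R) (A : H -> H) :
    set (set H) :=
  [set E | closed_subspace E /\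
           forall B, commutant [set A] B -> B @` E `<=` E].

(* L1 and L2 are meant to be subsets of the ambient types T1 and T2 that are
   closed under the given binary meet and join operations, as are the sets
   lat M A and hyperinvariant A above. *)
Definition lattice_isomorphic (T1 T2 : Type)
    (L1 : set T1) (meet1 join1 : T1 -> T1 -> T1)
    (L2 : set T2) (meet2 join2 : T2 -> T2 -> T2) : Prop :=
  exists f : T1 -> T2,
    set_bij L1 L2 f /\
    forall x y, L1 x -> L1 y ->
      f (meet1 x y) = meet2 (f x) (f y) /\
      f (join1 x y) = join2 (f x) (f y).

(* Main.v *)
Require Import Defs.
From HB Require Import structures.
From mathcomp Require Import all_boot all_order all_algebra.
From mathcomp Require Import sesquilinear.
From mathcomp Require Import complex.
From mathcomp Require Import all_classical all_reals all_analysis.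
From mathcomp Require Import ring lra.
Import numFieldNormedType.Exports.
Import Order.TTheory GRing.Theory Num.Theory Num.Def.

(** The maps E |-> closure (T E) and F |-> closure (S F) are monotone and carry
    closed invariant subspaces of ST to those of TS and back.  The point is that
    they are mutually inverse when S and T are injective, that is, that
    closure (ST E) = E for every closed ST-invariant E whose projection P lies
    in M ([finite_dense_image]).  This is where finiteness enters.  An injective
    operator A of a finite von Neumann algebra has dense range
    ([finite_dense_range]): in its polar decomposition A = U |A| the operator U
    is an isometry of M, hence a unitary by finiteness, so the adjoint of A is
    injective as well ([finite_injective_adjoint]).  Applying this to
    A P + (I - P) gives the relative version on E.

    The polar part U is built without square roots or functional calculus, as
    the strong limit of the Newton-Schulz iterates of a contraction
    ([polar]).  They converge because each of them is A times a polynomial in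
    I - A^* A with nonnegative coefficients, and these polynomials increase; the
    limit satisfies U U^* U = U by the recursion itself.

    A hyperinvariant subspace E of ST is in particular invariant under the
    commutant of M, so its projection lies in the bicommutant M and the
    preceding applies.  If B commutes with TS, then S B T commutes with ST,
    whence B T (ST E) = T (S B T) E is contained in T E; as ST E is dense in E,
    the closure of T E is again hyperinvariant ([hyper_image]).

    As for triviality, if both operators are injective, the isomorphism
    transports it ([trivial_transfer]).  If S, say, has a kernel, then neither
    lattice is trivial ([nontrivial_singular]): TS has a kernel, and ST has no
    dense range, because by finiteness the adjoint of S has a kernel too.  The
    kernel and the closed range are proper nonzero invariant subspaces unless
    the operator is 0, and then every projection of M is invariant; M contains a
    nontrivial one because the identity is not a minimal projection. *)

Local Open Scope classical_set_scope.
Local Open Scope ring_scope.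

Set Implicit Arguments.
Unset Strict Implicit.
Unset Printing Implicit Defensive.

(** * The real inner product and its topology *)

Section RealForm.
Variables (R : realType) (H : hilbert R).
Implicit Types (x y z : H) (r : R).

(** Norms take values in R[i], which is only partially ordered; all estimates
    are made with the real part of the inner product instead.  It loses nothing,
    since the imaginary part of the pairing with y is the real part of the
    pairing with i y ([inner_rdot]). *)
Definition rdot x y : R := complex.Re (inner H x y).
Definition sqn x : R := rdot x x.

Lemma rdotDl x y z : rdot (x + y) z = rdot x z + rdot y z.
Proof. by rewrite /rdot linearDl raddfD. Qed.

Lemma rdotC x y : rdot x y = rdot y x.
Proof.
rewrite /rdot (hermC (inner H) x y) expr0 mul1r.
by apply: (@complexI R); rewrite !complexRe Re_conj.
Qed.

Lemma rdotZl r x y : rdot (r%:C%C *: x) y = r * rdot x y.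
Proof.
have ReZ (z : R[i]) : complex.Re (r%:C%C * z) = r * complex.Re z.
  by case: z => a b; simpc.
by rewrite /rdot linearZl_LR ReZ.
Qed.

Lemma rdotDr x y z : rdot z (x + y) = rdot z x + rdot z y.
Proof. by rewrite !(rdotC z) rdotDl. Qed.

Lemma rdotZr r x y : rdot x (r%:C%C *: y) = r * rdot x y.
Proof. by rewrite !(rdotC x) rdotZl. Qed.

Lemma rdotNl x y : rdot (- x) y = - rdot x y.
Proof. by rewrite /rdot linearNl raddfN. Qed.

Lemma rdotNr x y : rdot x (- y) = - rdot x y.
Proof. by rewrite !(rdotC x) rdotNl. Qed.

Lemma rdot0l x : rdot 0 x = 0.
Proof. by rewrite /rdot linear0l. Qed.

Lemma rdot0r x : rdot x 0 = 0.
Proof. by rewrite rdotC rdot0l. Qed.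

Lemma rdotMnl x y n : rdot (x *+ n) y = rdot x y *+ n.
Proof. by elim: n => [|n IH]; rewrite ?mulr0n ?rdot0l// !mulrS rdotDl IH. Qed.

Lemma rdotMnr x y n : rdot x (y *+ n) = rdot x y *+ n.
Proof. by rewrite !(rdotC x) rdotMnl. Qed.

Definition rdotE := (rdotDl, rdotDr, rdotNl, rdotNr, rdotZl, rdotZr, rdotMnl, rdotMnr).

(** The norm is a nonnegative element of R[i], hence comes from R; this is the
    bridge between the norm of the space and the real function [sqn]. *)
Lemma norm_real x : exists2 r : R, 0 <= r & `|x| = (r%:C)%C.
Proof.
exists (complex.Re `|x|); last by rewrite RRe_real// ger0_real.
by rewrite -ler0c RRe_real// ger0_real.
Qed.

Lemma sqn_norm x r : `|x| = (r%:C)%C -> sqn x = r ^+ 2.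
Proof. by move=> e; rewrite /sqn /rdot inner_norm e -rmorphXn. Qed.

Lemma sqn_ge0 x : 0 <= sqn x.
Proof. by have [r _ /sqn_norm ->] := norm_real x; rewrite sqr_ge0. Qed.

Lemma sqn_eq0 x : sqn x = 0 -> x = 0.
Proof.
have [r r0 e] := norm_real x; rewrite (sqn_norm e) => /eqP.
by rewrite sqrf_eq0 => /eqP r00; apply/eqP; rewrite -normr_eq0 e r00.
Qed.

Lemma sqn0 : sqn 0 = 0. Proof. exact: rdot0l. Qed.

Lemma norm_ltE x r : 0 < r -> (`|x| < (r%:C)%C) = (sqn x < r ^+ 2).
Proof.
move=> r0; have [s s0 e] := norm_real x.
by rewrite e (sqn_norm e) ltcR ltr_pXn2r// nnegrE ltW.
Qed.

Lemma norm_leE x r : 0 <= r -> (`|x| <= (r%:C)%C) = (sqn x <= r ^+ 2).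
Proof.
move=> r0; have [s s0 e] := norm_real x.
by rewrite e (sqn_norm e) lecR ler_pXn2r.
Qed.

Lemma sqnN x : sqn (- x) = sqn x.
Proof. by rewrite /sqn !rdotE opprK. Qed.

Lemma sqnZ r x : sqn (r%:C%C *: x) = r ^+ 2 * sqn x.
Proof. by rewrite /sqn !rdotE expr2 mulrA. Qed.

Lemma sqnD x y : sqn (x + y) = sqn x + sqn y + 2 * rdot x y.
Proof. by rewrite /sqn !rdotE (rdotC y x); ring. Qed.

Lemma sqnB x y : sqn (x - y) = sqn x + sqn y - 2 * rdot x y.
Proof. by rewrite sqnD sqnN rdotNr mulrN. Qed.

Lemma sqn_distC x y : sqn (x - y) = sqn (y - x).
Proof. by rewrite -sqnN opprB. Qed.

Lemma sqnD_le x y : sqn (x + y) <= 2 * (sqn x + sqn y).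
Proof. by have := sqn_ge0 (x - y); rewrite sqnB sqnD; lra. Qed.

Lemma dist_split z x y : sqn (x - y) <= 2 * (sqn (x - z) + sqn (z - y)).
Proof. by rewrite -[x - y](subrKA z) sqnD_le. Qed.

(** The nonnegative quantity is the squared norm of |y|^2 x - <x, y> y, which
    avoids a division. *)
Lemma cauchy_schwarz x y : rdot x y ^+ 2 <= sqn x * sqn y.
Proof.
have [/sqn_eq0 ->|y0] := eqVneq (sqn y) 0.
  by rewrite rdot0r sqn0 mulr0 expr0n.
have yp : 0 < sqn y by rewrite lt_neqAle eq_sym y0 sqn_ge0.
have := sqn_ge0 (((sqn y)%:C)%C *: x - ((rdot x y)%:C)%C *: y).
rewrite sqnB !sqnZ !rdotE.
have -> : sqn y ^+ 2 * sqn x + rdot x y ^+ 2 * sqn y -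
    2 * (sqn y * (rdot x y * rdot x y)) =
    sqn y * (sqn x * sqn y - rdot x y ^+ 2) by ring.
by rewrite pmulr_rge0// subr_ge0.
Qed.

Lemma realC_gt0 (e : R[i]) : 0 < e -> exists2 r : R, 0 < r & e = (r%:C)%C.
Proof.
move=> e0; have er : e \is Num.real by rewrite gtr0_real.
exists (complex.Re e); last by rewrite RRe_real.
by rewrite -(ltcR 0) /= RRe_real.
Qed.

(** Together with [bounded_opP] and [sqn_complete] this expresses closure,
    continuity of operators and completeness by [sqn] alone. *)
Lemma closure_sqnP (E : set H) x :
  closure E x <-> forall e, 0 < e -> exists2 y, E y & sqn (x - y) < e.
Proof.
split=> [cE e e0|cE B].
- have s0 : 0 < Num.sqrt e by rewrite sqrtr_gt0.
  have /cE [y [Ey]] : nbhs x (ball x ((Num.sqrt e)%:C)%C).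
    by apply: nbhsx_ballx; rewrite -[0]/((0:R)%:C)%C ltcR.
  rewrite -ball_normE /= norm_ltE// sqr_sqrtr ?ltW// => ?.
  by exists y.
- move=> /nbhs_ballP[e /= /realC_gt0[r r0 ->] sB].
  have [y Ey d] := cE _ (exprn_gt0 2 r0).
  by exists y; split=> //; apply: sB; rewrite -ball_normE /= norm_ltE.
Qed.

Lemma bounded_opP (A : H -> H) : bounded_op A <->
  [/\ forall x y, A (x + y) = A x + A y, forall c x, A (c *: x) = c *: A x &
   exists2 C, 0 < C & forall x, sqn (A x) <= C * sqn x].
Proof.
split.
- move=> [lA cA].
  pose f : {linear H -> H} := HB.pack A (GRing.isLinear.Build _ _ _ _ _ lA).
  split; [exact: (linearD f)|by move=> c x; exact: (linearZ_LR f)|].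
  have := (@linear_bounded_continuous _ _ _ f).2 cA.
  move=> /linear_boundedP /pinfty_ex_gt0[M M0 bM].
  have [r r0 e] := realC_gt0 M0.
  exists (r ^+ 2); first by rewrite exprn_gt0.
  move=> x; have := bM x; rewrite e.
  have [s s0 es] := norm_real x; rewrite (sqn_norm es) es.
  rewrite -rmorphM norm_leE /=; last by rewrite mulr_ge0// ltW.
  by rewrite exprMn.
- move=> [AD AZ [C C0 bC]].
  have lA : linear A by move=> c x y; rewrite AD AZ.
  pose f : {linear H -> H} := HB.pack A (GRing.isLinear.Build _ _ _ _ _ lA).
  split=> //; apply: (@bounded_linear_continuous _ _ _ f); apply/linear_boundedP.
  have s0 : 0 <= Num.sqrt C by rewrite sqrtr_ge0.
  near=> M; move=> x.
  have : ((Num.sqrt C)%:C)%C <= M.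
    by near: M; apply: nbhs_pinfty_ge; rewrite realE -[0]/((0:R)%:C)%C !lecR s0.
  move=> /(ler_wpM2r (normr_ge0 x)); apply: le_trans.
  have [s ss es] := norm_real x; rewrite es -rmorphM norm_leE /=; last by rewrite mulr_ge0.
  by rewrite exprMn (sqr_sqrtr (ltW C0)) -(sqn_norm es) bC.
Unshelve. all: by end_near. Qed.

Definition converges (u : nat -> H) (l : H) :=
  forall e, 0 < e -> exists N, forall n, (N <= n)%N -> sqn (u n - l) < e.

Lemma sqn_complete (u : nat -> H) :
  (forall e, 0 < e -> exists N,
    forall m n, (N <= m)%N -> (N <= n)%N -> sqn (u m - u n) < e) ->
  exists l, converges u l.
Proof.
move=> cu.
have : cauchy (u @ \oo).
  apply/cauchy_ballP => e /realC_gt0[r r0 ->].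
  have [N uN] := cu _ (exprn_gt0 2 r0).
  rewrite near_map2 /=.
  exists ([set n | (N <= n)%N], [set n | (N <= n)%N]) => /=.
    by split; exists N.
  by move=> [a b] /= [Na Nb]; rewrite -ball_normE /= norm_ltE//; exact: uN.
move=> /cauchy_cvgP/cvg_ex[l ul]; exists l => e e0.
have s0 : 0 < Num.sqrt e by rewrite sqrtr_gt0.
have : \forall n \near \oo, `|l - u n| < ((Num.sqrt e)%:C)%C.
  by move/cvgrPdist_lt: ul; apply; rewrite -[0]/((0:R)%:C)%C ltcR.
move=> [N _ uN]; exists N => n Nn; have := uN n Nn; rewrite /= norm_ltE//.
by rewrite sqr_sqrtr ?ltW// sqn_distC.
Qed.
End RealForm.

(** * Bounded operators, closed subspaces, projections and adjoints *)

Section Operators.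
Variables (R : realType) (H : hilbert R).
Implicit Types (x y z : H) (r : R) (E F : set H) (A B C P Q : H -> H).

Lemma innerDl x y z : inner H (x + y) z = inner H x z + inner H y z.
Proof. exact: linearDl. Qed.

Lemma innerBl x y z : inner H (x - y) z = inner H x z - inner H y z.
Proof. exact: linearBl. Qed.

Lemma innerZl c x y : inner H (c *: x) y = c * inner H x y.
Proof. exact: linearZl_LR. Qed.

Lemma innerZr c x y : inner H x (c *: y) = conjC c * inner H x y.
Proof. exact: linearZr_LR. Qed.

Lemma rdot_ext x y : (forall z, rdot x z = rdot y z) -> x = y.
Proof.
move=> xy; apply/eqP; rewrite -subr_eq0; apply/eqP/sqn_eq0.
by rewrite /sqn rdotDl rdotNl xy subrr.
Qed.

Lemma rdotZC (c : R[i]) x y : rdot (c *: x) y = rdot x (conjC c *: y).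
Proof.
by rewrite /rdot linearZl_LR linearZr_LR /= conjCK.
Qed.

Lemma inner_rdot x y : inner H x y = (rdot x y +i* rdot x ('i%C *: y))%C.
Proof.
have E (z : R[i]) : z = (complex.Re z +i* complex.Re (conjC 'i * z))%C.
  by rewrite conjCi mulNr -complexiE mulrC raddfN /= ReiNIm opprK; case: z.
by rewrite [LHS]E /rdot [in RHS]linearZr_LR complexiE.
Qed.

Lemma adj_rdot A B : is_adjoint A B -> forall x y, rdot (A x) y = rdot x (B y).
Proof. by move=> AB x y; rewrite /rdot AB. Qed.

(** Complex-linearity of B turns an adjunction for the real parts into an
    adjunction for the complex inner product. *)
Lemma rdot_adj A B : bounded_op B ->
  (forall x y, rdot (A x) y = rdot x (B y)) -> is_adjoint A B.
Proof.
by move=> /bounded_opP[_ BZ _] AB x y; rewrite !inner_rdot !AB BZ.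
Qed.

Lemma adj_rdot_sym A B : is_adjoint A B -> forall x y, rdot (B x) y = rdot x (A y).
Proof. by move=> /adj_rdot AB x y; rewrite rdotC -AB rdotC. Qed.

Lemma bopD A : bounded_op A -> forall x y, A (x + y) = A x + A y.
Proof. by move=> /bounded_opP[]. Qed.

Lemma bopZ A : bounded_op A -> forall c x, A (c *: x) = c *: A x.
Proof. by move=> /bounded_opP[]. Qed.

Lemma bop0 A : bounded_op A -> A 0 = 0.
Proof. by move=> /bopZ /(_ 0 0); rewrite !scale0r. Qed.

Lemma bopN A : bounded_op A -> forall x, A (- x) = - A x.
Proof. by move=> /bopZ AZ x; rewrite -scaleN1r AZ scaleN1r. Qed.

Lemma bopB A : bounded_op A -> forall x y, A (x - y) = A x - A y.
Proof. by move=> hA x y; rewrite bopD// bopN. Qed.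

Lemma bop_bound A : bounded_op A -> exists2 C, 0 < C & forall x, sqn (A x) <= C * sqn x.
Proof. by move=> /bounded_opP[]. Qed.

Lemma bop_of_contraction A : (forall x y, A (x + y) = A x + A y) ->
  (forall c x, A (c *: x) = c *: A x) -> (forall x, sqn (A x) <= sqn x) ->
  bounded_op A.
Proof. by move=> AD AZ bA; apply/bounded_opP; split=> //; exists 1 => // x; rewrite mul1r. Qed.

Lemma bop_id : bounded_op (id : H -> H).
Proof. by apply: bop_of_contraction. Qed.

Lemma bop_comp A B : bounded_op A -> bounded_op B -> bounded_op (A \o B).
Proof.
move=> /bounded_opP[AD AZ [C C0 bA]] /bounded_opP[BD BZ [D D0 bB]].
apply/bounded_opP; split=> [x y|c x|]; rewrite /= ?BD ?BZ//.
exists (C * D) => [|x]; first exact: mulr_gt0.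
by rewrite (le_trans (bA _))// -mulrA ler_pM2l.
Qed.

Lemma bop_add A B : bounded_op A -> bounded_op B -> bounded_op (fun x => A x + B x).
Proof.
move=> /bounded_opP[AD AZ [C C0 bA]] /bounded_opP[BD BZ [D D0 bB]].
apply/bounded_opP; split=> [x y|c x|].
- by rewrite AD BD addrACA.
- by rewrite AZ BZ scalerDr.
- exists (2 * (C + D)) => [|x]; first by rewrite mulr_gt0// addr_gt0.
  have := sqnD_le (A x) (B x); have := bA x; have := bB x; lra.
Qed.

Lemma bop_scale (c : R[i]) A : bounded_op A -> bounded_op (fun x => c *: A x).
Proof.
move=> hA; apply: (@bop_comp ( *:%R c) A) => //.
apply/bounded_opP; split=> [x y|d x|]; first exact: scalerDr.
  by rewrite !scalerA mulrC.
have [r re] : exists r, conjC c * c = (r%:C)%C.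
  by exists (complex.Re (conjC c * c)); rewrite RRe_real// mulrC -normCK realX// normr_real.
exists (1 + `|r|) => [|x]; first by rewrite ltr_pwDl.
rewrite {1}/sqn rdotZC scalerA re rdotZr ler_wpM2r ?sqn_ge0//.
by have := ler_norm r; lra.
Qed.

Lemma bop_sub A B : bounded_op A -> bounded_op B -> bounded_op (fun x => A x - B x).
Proof.
move=> hA hB; have -> : (fun x => A x - B x) = (fun x => A x + (-1) *: B x).
  by apply/funext => x; rewrite scaleN1r.
by apply: bop_add => //; apply: bop_scale.
Qed.

Lemma csub0 E : closed_subspace E -> E 0. Proof. by case. Qed.

Lemma csubD E : closed_subspace E -> forall x y, E x -> E y -> E (x + y).
Proof. by case=> _ _ lE x y Ex Ey; rewrite -[x]scale1r; exact: lE. Qed.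

Lemma csubZ E : closed_subspace E -> forall (c : R[i]) x, E x -> E (c *: x).
Proof. by case=> _ E0 lE c x Ex; rewrite -[c *: x]addr0; exact: lE. Qed.

Lemma csubB E : closed_subspace E -> forall x y, E x -> E y -> E (x - y).
Proof. by move=> cE x y Ex Ey; apply: csubD => //; rewrite -scaleN1r; exact: csubZ. Qed.

Lemma csub_closure E : closed_subspace E -> closure E `<=` E.
Proof. by case. Qed.

Lemma csubP E : closed_subspace E ->
  forall x, (forall e, 0 < e -> exists2 y, E y & sqn (x - y) < e) -> E x.
Proof. by move=> /csub_closure cE x /closure_sqnP /cE. Qed.

Lemma csub_setI E F : closed_subspace E -> closed_subspace F ->
  closed_subspace (E `&` F).
Proof.
move=> [cE E0 lE] [cF F0 lF]; split=> //; first exact: closedI.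
by move=> c x y [Ex Fx] [Ey Fy]; split; [exact: lE|exact: lF].
Qed.

Lemma csub_closureI E : E 0 -> (forall (c : R[i]) x y, E x -> E y -> E (c *: x + y)) ->
  closed_subspace (closure E).
Proof.
move=> E0 lE; split; [exact: closed_closure|exact: subset_closure|].
move=> c x y /closure_sqnP cx /closure_sqnP cy; apply/closure_sqnP => e e0.
have [K K0 bK] := bop_bound (bop_scale c bop_id).
have d0 : 0 < e / (4 * K) by rewrite divr_gt0// mulr_gt0.
have [a Ea xa] := cx _ d0.
have e40 : 0 < e / 4 by rewrite divr_gt0.
have [b Eb yb] := cy _ e40.
exists (c *: a + b); first exact: lE.
rewrite opprD addrACA -scalerBr.
have := sqnD_le (c *: (x - a)) (y - b); have := bK (x - a).
have : K * sqn (x - a) < e / 4.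
  have -> : e / 4 = K * (e / (4 * K)) by field; rewrite gt_eqF.
  by rewrite ltr_pM2l.
lra.
Qed.

Lemma bop_closure A E F : bounded_op A -> A @` E `<=` F -> A @` closure E `<=` closure F.
Proof.
move=> hA EF _ [x /closure_sqnP cx <-]; apply/closure_sqnP => e e0.
have [K K0 bK] := bop_bound hA.
have d0 : 0 < e / K by rewrite divr_gt0.
have [y Ey xy] := cx _ d0; exists (A y); first by apply: EF; exists y.
by rewrite -bopB// (le_lt_trans (bK _))// mulrC -ltr_pdivlMr.
Qed.

Lemma csub_closure_image A E : bounded_op A -> closed_subspace E ->
  closed_subspace (closure (A @` E)).
Proof.
move=> hA cE; apply: csub_closureI.
  by exists 0; [exact: csub0|exact: bop0].
move=> c _ _ [x Ex <-] [y Ey <-]; exists (c *: x + y).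
  by apply: csubD => //; apply: csubZ.
by rewrite bopD// bopZ.
Qed.

Lemma csub_kernel A : bounded_op A -> closed_subspace (null_space A).
Proof.
move=> hA; split=> [x /closure_sqnP cx||c x y]; rewrite /null_space /= ?bop0//; last first.
  by rewrite bopD// bopZ// => -> ->; rewrite scaler0 addr0.
have [K K0 bK] := bop_bound hA.
apply: sqn_eq0; apply/eqP; rewrite eq_le sqn_ge0 andbT; apply/ler_addgt0Pl => e e0.
have d0 : 0 < e / K by rewrite divr_gt0.
have [y Ay xy] := cx _ d0.
rewrite addr0 ltW// -[A x]subr0 -Ay -bopB//.
by rewrite (le_lt_trans (bK _))// mulrC -ltr_pdivlMr.
Qed.

Lemma csub_setT : closed_subspace (setT : set H).
Proof. by split=> //; exact: closedT. Qed.

Lemma csub_set0 : closed_subspace ([set 0] : set H).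
Proof.
have <- : null_space (id : H -> H) = [set 0] by [].
exact: csub_kernel bop_id.
Qed.

Lemma csub_join E F : closed_subspace E -> closed_subspace F ->
  closed_subspace (subspace_join E F).
Proof.
move=> cE cF; apply: csub_closureI.
  by exists 0; [exact: csub0|exists 0; [exact: csub0|rewrite addr0]].
move=> c _ _ [x Ex [y Fy <-]] [x' Ex' [y' Fy' <-]].
exists (c *: x + x'); first by case: cE => _ _; apply.
exists (c *: y + y'); first by case: cF => _ _; apply.
by rewrite scalerDr addrACA.
Qed.

(** An abstract vanishing sequence keeps the terms 1/(n+1) out of the linear
    arithmetic below. *)
Lemma null_sequence : exists2 ep : nat -> R, forall n, 0 < ep n &
  forall e, 0 < e -> exists N, forall n, (N <= n)%N -> ep n < e.
Proof.
exists (fun n => n.+1%:R^-1) => [n|e e0]; first by rewrite invr_gt0 ltr0n.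
have [N _ hN] := near_infty_natSinv_lt (PosNum e0).
by exists N => n Nn; exact: hN.
Qed.

(** A minimizing sequence for the distance of x to E is Cauchy by the
    parallelogram law, because midpoints stay in E.  The residuals x - u n are
    almost orthogonal to E by minimality, which passes to the limit. *)
Lemma nearest_point E x : closed_subspace E ->
  exists2 p, E p & forall y, E y -> rdot (x - p) y = 0.
Proof.
move=> cE; have [ep ep0 hep] := null_sequence; pose D := [set sqn (x - y) | y in E].
have D0 : D !=set0 by exists (sqn (x - 0)), 0 => //; exact: csub0.
have Dlb : has_lbound D by exists 0 => _ [y _ <-]; exact: sqn_ge0.
have [d dE] : exists d, d = inf D by exists (inf D).
have dle y : E y -> d <= sqn (x - y) by move=> Ey; rewrite dE; apply: ge_inf => //; exists y.
have /choice[u hu] : forall n : nat, exists y, E y /\ sqn (x - y) < d + ep n.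
  move=> n; have [//||_ [y Ey <-] yd] := @inf_adherent _ D (ep n); first by split.
  by exists y; rewrite dE.
have uE n : E (u n) by have [] := hu n.
have ud n : sqn (x - u n) < d + ep n by have [] := hu n.
have cu m n : sqn (u m - u n) < 2 * (ep m + ep n).
  have Em : E ((2^-1%:C)%C *: (u m + u n)) by apply: csubZ => //; apply: csubD.
  have := dle _ Em; have := ud m; have := ud n.
  have -> : u m - u n = (x - u n) - (x - u m).
    by rewrite opprB [RHS]addrC subrKA.
  have -> : x - (2^-1%:C)%C *: (u m + u n) = (2^-1%:C)%C *: ((x - u n) + (x - u m)).
    have {1}-> : x = (2^-1%:C)%C *: (x + x).
      rewrite -mulr2n -(@scaler_nat R[i] H 2 x) scalerA -(rmorph_nat (real_complex R)) -rmorphM.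
      by rewrite mulVf ?scale1r// pnatr_eq0.
    by rewrite -scalerBr addrACA -opprD (addrC (u n)).
  move: (x - u n) (x - u m) => a b; rewrite sqnZ (sqnB a b) (sqnD a b).
  have -> : (2^-1 : R) ^+ 2 = 4^-1 by field.
  lra.
have [p up] : exists p, converges u p.
  apply: sqn_complete => e e0; have [|N hN] := hep (e / 4); first by rewrite divr_gt0.
  exists N => m n /hN hm /hN hn; have := cu m n; lra.
have Ep : E p.
  apply: csubP => // e /up[N hN]; exists (u N) => //; rewrite sqn_distC; exact: hN.
exists p => // y Ey.
have [/sqn_eq0 ->|y0] := eqVneq (sqn y) 0; first by rewrite rdot0r.
have yp : 0 < sqn y by rewrite lt_neqAle eq_sym y0 sqn_ge0.
have key n : rdot (x - u n) y ^+ 2 <= ep n * sqn y.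
  (* Moving u n by a / |y|^2 along y decreases the squared distance by a^2 / |y|^2. *)
  set a := rdot _ _.
  have Ez : E (u n + ((a / sqn y)%:C)%C *: y) by apply: csubD => //; apply: csubZ.
  have := dle _ Ez; rewrite opprD addrA sqnB sqnZ rdotZr -/a => h.
  have {h} : a ^+ 2 / sqn y <= ep n.
    have -> : a ^+ 2 / sqn y = - ((a / sqn y) ^+ 2 * sqn y - 2 * (a / sqn y * a)).
      by field.
    have := ud n; lra.
  by rewrite ler_pdivrMr.
apply/eqP; rewrite -sqrf_eq0 eq_le sqr_ge0 andbT.
apply/ler_addgt0Pl => e e0; rewrite addr0.
have [|N hN] := hep (e / (4 * sqn y)); first by rewrite divr_gt0// mulr_gt0.
have [|N' hN'] := up (e / (4 * sqn y)); first by rewrite divr_gt0// mulr_gt0.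
pose n := maxn N N'.
have h1 := hN _ (leq_maxl N N'); have h2 := hN' _ (leq_maxr N N').
rewrite -/n in h1 h2.
have -> : x - p = (x - u n) + (u n - p) by rewrite subrKA.
rewrite rdotDl.
have h3 := key n; have h4 := cauchy_schwarz (u n - p) y.
rewrite ltr_pdivlMr ?mulr_gt0// in h1; rewrite ltr_pdivlMr ?mulr_gt0// in h2.
have := sqr_ge0 (rdot (x - u n) y - rdot (u n - p) y).
nra.
Qed.

Lemma ortho_unique E x a b : closed_subspace E -> E a -> E b ->
  (forall y, E y -> rdot (x - a) y = 0) ->
  (forall y, E y -> rdot (x - b) y = 0) -> a = b.
Proof.
move=> cE Ea Eb ha hb; apply/eqP; rewrite -subr_eq0; apply/eqP/sqn_eq0.
rewrite /sqn; have Eab : E (a - b) by exact: csubB.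
have -> : rdot (a - b) (a - b) = rdot (x - b) (a - b) - rdot (x - a) (a - b).
  by rewrite -rdotNl -rdotDl opprB [in RHS]addrC subrKA.
by rewrite ha// hb// subrr.
Qed.

Lemma proj_exists E : closed_subspace E -> exists2 P, projection P & range P = E.
Proof.
move=> cE; have /choice[P hP] : forall x, exists p, E p /\ forall y, E y -> rdot (x - p) y = 0.
  by move=> x; have [p] := nearest_point x cE; exists p.
have EP x : E (P x) by have [] := hP x.
have oP x y : E y -> rdot (x - P x) y = 0 by have [_] := hP x; apply.
have Pid y : E y -> P y = y.
  move=> Ey; apply: (@ortho_unique E y) => //; first exact: oP.
  by move=> z _; rewrite subrr rdot0l.
have bP : bounded_op P.
  apply: bop_of_contraction => [x y|c x|x].
  - apply: (@ortho_unique E (x + y)) => //; [exact: csubD|exact: oP|].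
    by move=> z Ez; rewrite opprD addrACA rdotDl !oP// addr0.
  - apply: (@ortho_unique E (c *: x)) => //; [exact: csubZ|exact: oP|].
    by move=> z Ez; rewrite -scalerBr rdotZC oP//; exact: csubZ.
  - rewrite -[in leRHS](subrK (P x) x) [leRHS]sqnD oP//.
    by have := sqn_ge0 (x - P x); lra.
exists P; last first.
  by apply/seteqP; split=> [_ [x _ <-]//|x Ex]; exists x => //; exact: Pid.
split=> //; first by apply/funext => x /=; exact: Pid.
apply: rdot_adj => // x y.
have h1 := oP x (P y) (EP y); have h2 := oP y (P x) (EP x).
move: h1 h2; rewrite !rdotE (rdotC y (P x)) (rdotC (P y)); lra.
Qed.

Lemma proj_idem P : projection P -> forall x, P (P x) = P x.
Proof. by move=> [_ PP _] x; rewrite -[in RHS]PP. Qed.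

Lemma proj_sa P : projection P -> forall x y, rdot (P x) y = rdot x (P y).
Proof. by move=> [_ _ /adj_rdot]. Qed.

Lemma proj_bop P : projection P -> bounded_op P. Proof. by case. Qed.

Lemma proj_rangeP P : projection P -> forall x, range P x <-> P x = x.
Proof.
move=> hP x; split=> [[y _ <-]|<-]; first exact: proj_idem.
by exists x.
Qed.

(** Equal ranges give Q P = P and P Q = Q; taking adjoints in the second
    identity yields Q P = Q. *)
Lemma proj_unique P Q : projection P -> projection Q -> range P = range Q -> P = Q.
Proof.
move=> hP hQ PQ; apply/funext => x; apply: rdot_ext => y.
have QP z : Q (P z) = P z by apply/(proj_rangeP hQ); rewrite -PQ; exists z.
have PQ' z : P (Q z) = Q z by apply/(proj_rangeP hP); rewrite PQ; exists z.
by rewrite proj_sa// -QP -proj_sa// -proj_sa// PQ'.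
Qed.

Lemma csub_range P : projection P -> closed_subspace (range P).
Proof.
move=> hP; have -> : range P = null_space (fun x => x - P x).
  apply/seteqP; split=> x; first by move=> /(proj_rangeP hP) e; rewrite /null_space /= e subrr.
  by move=> /eqP; rewrite subr_eq0 => /eqP e; apply/(proj_rangeP hP).
by apply/csub_kernel/bop_sub; [exact: bop_id|exact: proj_bop].
Qed.

Lemma proj_ontoP E : closed_subspace E ->
  projection (proj_onto E) /\ range (proj_onto E) = E.
Proof.
move=> cE; rewrite /proj_onto; case: xgetP => [P _ //|none].
by have [P hP rP] := proj_exists cE; case: (none P).
Qed.

Lemma proj_onto_range P : projection P -> proj_onto (range P) = P.
Proof.
move=> hP; have [pP rP] := proj_ontoP (csub_range hP).
exact: proj_unique.
Qed.

(** A closed subspace with trivial orthogonal complement is everything, as the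
    residual of a nearest point is orthogonal to it. *)
Lemma dense_of_ortho E : closed_subspace E ->
  (forall z, (forall y, E y -> rdot z y = 0) -> z = 0) -> E = setT.
Proof.
move=> cE h; apply/seteqP; split=> // x _.
have [p Ep xp] := nearest_point x cE.
by have /eqP := h _ xp; rewrite subr_eq0 => /eqP ->.
Qed.

(** The Riesz argument: the kernel K of the functional x |-> <B x, y> is a closed
    hyperplane, unless the functional is 0, and a vector w orthogonal to K,
    suitably rescaled, represents it. *)
Lemma adjoint_exists B : bounded_op B -> exists2 C, bounded_op C & is_adjoint B C.
Proof.
move=> hB.
have riesz y : exists z, forall x, inner H (B x) y = inner H x z.
  pose K : set H := [set x | inner H (B x) y = 0].
  have cK : closed_subspace K.
    split=> [x /closure_sqnP cx||c x x']; rewrite /K /= ?bop0 ?linear0l//; last first.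
      by move=> h h'; rewrite bopD// bopZ// innerDl h' addr0 innerZl h mulr0.
    have [C C0 bC] := bop_bound hB.
    have aux z : (forall w, K w -> rdot (B w) z = 0) -> rdot (B x) z = 0.
      move=> hz; apply/eqP; rewrite -sqrf_eq0 eq_le sqr_ge0 andbT.
      apply/ler_addgt0Pl => e e0; rewrite addr0.
      have s0 : 0 < C * sqn z + 1 by rewrite ltr_wpDl// mulr_ge0 ?sqn_ge0// ltW.
      have [w Kw xw] := cx _ (divr_gt0 e0 s0).
      have -> : rdot (B x) z = rdot (B (x - w)) z.
        by rewrite (bopB hB) rdotDl rdotNl (hz _ Kw) oppr0 addr0.
      rewrite (le_trans (cauchy_schwarz _ _))//.
      rewrite ltr_pdivlMr// in xw.
      have := bC (x - w); have := sqn_ge0 z; have := sqn_ge0 (x - w); nra.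
    rewrite inner_rdot !aux// => w; rewrite /K /= inner_rdot.
      by case.
    by case.
  have [KT|] := pselect (K = setT).
    exists 0 => x; rewrite linear0r.
    by have : K x by rewrite KT.
  move=> /(contra_not (dense_of_ortho cK)) /existsNP[w /not_implyP[wK w0]].
  have wK' k : K k -> inner H k w = 0.
    move=> Kk; rewrite inner_rdot rdotC wK//.
    by rewrite rdotC rdotZC wK//; exact: csubZ.
  set a := inner H (B w) y.
  have a0 : a != 0.
    apply: contra_notN w0 => /eqP aw; apply: sqn_eq0.
    by rewrite /sqn wK.
  have s0 : inner H w w != 0.
    apply: contra_notN w0 => /eqP ww; apply: sqn_eq0.
    by rewrite /sqn /rdot ww.
  exists (conjC (a / inner H w w) *: w) => x.
  have : K (x - (inner H (B x) y / a) *: w).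
    by rewrite /K /= bopB// bopZ// innerBl innerZl -/a divfK// subrr.
  move=> /wK'; rewrite innerBl innerZl => /eqP; rewrite subr_eq0 => /eqP e.
  rewrite innerZr conjCK e; field.
  by rewrite a0 s0.
have [C hC] := choice riesz; exists C => //.
have adj : is_adjoint B C by move=> x y; exact: hC.
have rC := adj_rdot_sym adj; have rB := adj_rdot adj.
have CD x y : C (x + y) = C x + C y.
  by apply: rdot_ext => z; rewrite rC !rdotDl !rC.
have CZ c x : C (c *: x) = c *: C x.
  by apply: rdot_ext => z; rewrite rC !rdotZC rC bopZ.
apply/bounded_opP; split=> //; have [K K0 bK] := bop_bound hB.
exists K => // x.
have [->|n0] := eqVneq (sqn (C x)) 0; first by rewrite mulr_ge0 ?sqn_ge0// ltW.
have np : 0 < sqn (C x) by rewrite lt_neqAle eq_sym n0 sqn_ge0.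
rewrite -(ler_pM2l np) -expr2 {1}/sqn rC rdotC.
rewrite (le_trans (cauchy_schwarz _ _))// mulrA ler_wpM2r ?sqn_ge0// mulrC.
by rewrite (le_trans (bK _))// mulrC.
Qed.
End Operators.

(** * Convergence in norm *)

Section Limits.
Variables (R : realType) (H : hilbert R).
Implicit Types (x y z l : H) (r : R) (u v : nat -> H) (A B : H -> H).

Lemma conv_rdot u l y : converges u l -> (fun n => rdot (u n) y) @ \oo --> rdot l y.
Proof.
move=> ul; apply/cvgrPdist_lt => e e0.
have s0 : 0 < sqn y + 1 by rewrite ltr_wpDl ?sqn_ge0.
have [N hN] := ul _ (divr_gt0 (exprn_gt0 2 e0) s0).
exists N => // n Nn /=.
have := hN n Nn; rewrite ltr_pdivlMr// => h.
rewrite -(@ltr_pXn2r _ 2)// ?nnegrE ?(ltW e0)// real_normK ?num_real//.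
rewrite -rdotNl -rdotDl (le_lt_trans (cauchy_schwarz _ _))// (sqn_distC l).
rewrite (le_lt_trans _ h)// ler_wpM2l ?sqn_ge0//; lra.
Qed.

Lemma conv_unique u l l' : converges u l -> converges u l' -> l = l'.
Proof.
move=> ul ul'; apply: rdot_ext => z.
have hl := @norm_hausdorff _ R^o.
by rewrite -(cvg_lim hl (conv_rdot (y := z) ul)) (cvg_lim hl (conv_rdot ul')).
Qed.

Lemma conv_sqn_le u l c : converges u l -> (forall n, sqn (u n) <= c) -> sqn l <= c.
Proof.
move=> ul uc.
suff : sqn l <= (c + sqn l) / 2 by lra.
have := conv_rdot (y := l) ul => h; rewrite [leLHS]/sqn -(cvg_lim (@norm_hausdorff _ R^o) h).
apply: limr_le; first by apply/cvg_ex; exists (rdot l l).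
near=> n; have := uc n; have := sqn_ge0 (u n - l); rewrite sqnB; lra.
Unshelve. all: by end_near. Qed.

Lemma conv_bop A u l : bounded_op A -> converges u l -> converges (A \o u) (A l).
Proof.
move=> hA ul e e0; have [K K0 bK] := bop_bound hA.
have [N hN] := ul _ (divr_gt0 e0 K0); exists N => n /hN.
rewrite ltr_pdivlMr// => h; rewrite /= -bopB// (le_lt_trans (bK _))// mulrC//.
Qed.

Lemma conv_add u v l l' : converges u l -> converges v l' ->
  converges (fun n => u n + v n) (l + l').
Proof.
move=> ul vl e e0; have e4 : 0 < e / 4 by rewrite divr_gt0.
have [N hN] := ul _ e4; have [N' hN'] := vl _ e4.
exists (maxn N N') => n; rewrite geq_max => /andP[/hN h /hN' h'].
rewrite opprD addrACA (le_lt_trans (sqnD_le _ _))//; lra.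
Qed.

Lemma conv_shift u l : converges u l -> converges (fun n => u n.+1) l.
Proof. by move=> ul e /ul[N hN]; exists N => n Nn; apply: hN; exact: leqW. Qed.

Lemma conv_ext u v l : u =1 v -> converges u l -> converges v l.
Proof. by move=> uv ul e /ul[N hN]; exists N => n Nn; rewrite -uv; exact: hN. Qed.

(** Joint continuity of application under strong convergence holds because the
    operators are uniformly bounded. *)
Lemma conv_strong (X : nat -> H -> H) (U : H -> H) v l :
  (forall n, bounded_op (X n)) -> (forall n x, sqn (X n x) <= sqn x) ->
  (forall x, converges (X ^~ x) (U x)) ->
  converges v l -> converges (fun n => X n (v n)) (U l).
Proof.
move=> bX cX XU vl.
apply: (@conv_ext (fun n => X n (v n - l) + X n l)).
  by move=> n; rewrite -bopD// subrK.
rewrite -[U l]add0r; apply: conv_add => // e e0.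
have [N hN] := vl _ e0; exists N => n /hN h.
by rewrite subr0 (le_lt_trans (cX _ _)).
Qed.

(** The form in which a bounded increasing sequence of positive operators
    converges strongly: a controls the increments of u. *)
Lemma conv_monotone u (a : nat -> R) c :
  (forall n, a n <= c) ->
  (forall k m, sqn (u (k + m)%N - u k) <= a (k + m)%N - a k) ->
  exists l, converges u l.
Proof.
move=> ac ua; apply: sqn_complete => e e0.
have [s sE] : exists s, s = sup (range a) by eexists.
have hs : has_sup (range a).
  by split; [exists (a 0%N), 0%N|exists c => _ [n _ <-]].
have [|_ [N _ <-] aN] := @sup_adherent _ (range a) (e / 4) _ hs; first by rewrite divr_gt0.
rewrite -sE in aN.
have as_ n : a n <= s by rewrite sE; apply: sup_upper_bound => //; exists n.
have uN n : (N <= n)%N -> sqn (u n - u N) < e / 4.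
  move=> /subnKC <-; have := ua N (n - N)%N; have := as_ (N + (n - N))%N; lra.
exists N => m n /uN hm /uN hn; have := dist_split (u N) (u m) (u n).
rewrite (sqn_distC (u N) (u n)); lra.
Qed.

End Limits.

(** * Commutants *)

Section Commutant.
Variables (R : realType) (H : hilbert R) (X : set (H -> H)).
Implicit Types (A B C : H -> H).

Lemma commutant_id : commutant X id.
Proof. by split; first exact: bop_id. Qed.

Lemma commutantP A : commutant X A <->
  bounded_op A /\ forall C x, X C -> C (A x) = A (C x).
Proof.
split=> -[hA cA]; split=> // C; first by move=> x /cA CA; exact: (congr1 (@^~ x) CA).
by move=> XC; apply/funext => x; exact: cA.
Qed.

Lemma commutant_comp A B : commutant X A -> commutant X B -> commutant X (A \o B).
Proof.
move=> /commutantP[hA cA] /commutantP[hB cB]; apply/commutantP.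
by split=> [|C x XC /=]; [exact: bop_comp|rewrite cA// cB].
Qed.

Lemma commutant_add A B : X `<=` @bounded_op R H ->
  commutant X A -> commutant X B -> commutant X (fun x => A x + B x).
Proof.
move=> bX /commutantP[hA cA] /commutantP[hB cB]; apply/commutantP; split; first exact: bop_add.
by move=> C x XC; rewrite (bopD (bX _ XC)) cA// cB.
Qed.

Lemma commutant_scale A c : X `<=` @bounded_op R H ->
  commutant X A -> commutant X (fun x => c *: A x).
Proof.
move=> bX /commutantP[hA cA]; apply/commutantP; split; first exact: bop_scale.
by move=> C x XC; rewrite (bopZ (bX _ XC)) cA.
Qed.

Lemma commutant_sub A B : X `<=` @bounded_op R H ->
  commutant X A -> commutant X B -> commutant X (fun x => A x - B x).
Proof.
move=> bX cA cB; have -> : (fun x => A x - B x) = (fun x => A x + (-1) *: B x).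
  by apply/funext => x; rewrite scaleN1r.
by apply: commutant_add => //; exact: commutant_scale.
Qed.

(** This keeps the limit of an iteration inside the von Neumann algebra. *)
Lemma commutant_lim (Z : nat -> H -> H) A : X `<=` @bounded_op R H ->
  bounded_op A -> (forall x, converges (Z ^~ x) (A x)) ->
  (forall k, commutant X (Z k)) -> commutant X A.
Proof.
move=> bX hA ZA cZ; apply/commutantP; split=> // C x XC.
apply: (conv_unique (conv_bop (bX _ XC) (ZA x))).
apply: (conv_ext _ (ZA (C x))) => k /=.
by have /commutantP[_ ->] := cZ k.
Qed.

End Commutant.

(** * The Newton-Schulz iteration and the polar decomposition *)

Section NewtonSchulz.
Variables (R : realType) (H : hilbert R).
Implicit Types (x y z l : H) (r : R) (A B E F G : H -> H).

(** [nnpoly E F] says that F is a polynomial in E with nonnegative coefficients.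
    These operators commute with E and inherit its positivity; keeping track of
    the signs of the coefficients replaces the fact that a product of commuting
    positive operators is positive, whose usual proof takes a square root. *)
Inductive nnpoly E : (H -> H) -> Prop :=
| nnpoly_pow n : nnpoly E (iter n E)
| nnpoly_add F G : nnpoly E F -> nnpoly E G -> nnpoly E (fun x => F x + G x)
| nnpoly_scale r F : 0 <= r -> nnpoly E F -> nnpoly E (fun x => (r%:C)%C *: F x).

Lemma iter_bop E n : bounded_op E -> bounded_op (iter n E).
Proof. by move=> hE; elim: n => [|n IH]; [exact: bop_id|exact: bop_comp]. Qed.

Lemma nnpoly_bop E F : bounded_op E -> nnpoly E F -> bounded_op F.
Proof.
move=> hE; elim=> [n|{}F G _ ? _ ?|r {}F _ _ ?]; [exact: iter_bop|exact: bop_add|].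
exact: bop_scale.
Qed.

Lemma nnpoly_iterl E F n : bounded_op E -> nnpoly E F -> nnpoly E (fun x => iter n E (F x)).
Proof.
move=> hE; have hn := iter_bop n hE; elim=> [m|{}F G _ hF _ hG|r {}F r0 _ hF].
- have -> : (fun x => iter n E (iter m E x)) = iter (n + m) E; last exact: nnpoly_pow.
  by apply/funext => x; rewrite iterD.
- have -> : (fun x => iter n E (F x + G x)) = (fun x => iter n E (F x) + iter n E (G x)).
    by apply/funext => x; rewrite bopD.
  exact: nnpoly_add.
- have -> : (fun x => iter n E ((r%:C)%C *: F x)) = (fun x => (r%:C)%C *: iter n E (F x)).
    by apply/funext => x; rewrite bopZ.
  exact: nnpoly_scale.
Qed.

Lemma nnpoly_comp E F G : bounded_op E -> nnpoly E F -> nnpoly E G ->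
  nnpoly E (fun x => F (G x)).
Proof.
move=> hE pF pG; elim: pF => [n|{}F F' _ h _ h'|r {}F r0 _ h].
- exact: nnpoly_iterl.
- exact: nnpoly_add h h'.
- exact: nnpoly_scale r0 h.
Qed.

Lemma nnpoly_commE E F x : bounded_op E -> nnpoly E F -> F (E x) = E (F x).
Proof.
move=> hE; elim=> [n|{}F G _ hF _ hG|r {}F r0 _ hF].
- by rewrite -iterSr.
- by rewrite hF hG bopD.
- by rewrite hF bopZ.
Qed.

Lemma nnpoly_sa E F x y : bounded_op E -> (forall x y, rdot (E x) y = rdot x (E y)) ->
  nnpoly E F -> rdot (F x) y = rdot x (F y).
Proof.
move=> hE saE; elim=> [n|{}F G _ hF _ hG|r {}F r0 _ hF].
- by elim: n x y => //= n IH x y; rewrite saE IH -iterSr.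
- by rewrite rdotDl rdotDr hF hG.
- by rewrite rdotZl rdotZr hF.
Qed.

(** The hypotheses say that 0 <= E <= I and E^2 <= E, in terms of forms. *)
Section Positivity.
Variable E : H -> H.
Hypothesis hE : bounded_op E.
Hypothesis saE : forall x y, rdot (E x) y = rdot x (E y).
Hypothesis sqE : forall x, sqn (E x) <= rdot (E x) x.
Hypothesis leE : forall x, rdot (E x) x <= sqn x.

(** Halving the exponent writes the forms of E^n and of E^(n+1) at x as those of
    I and E, or of E and E^2, at the vector y = E^(n/2) x. *)
Lemma iter_split n x : exists y,
     rdot (iter n E x) x = sqn y /\ rdot (E (iter n E x)) x = rdot (E y) y
  \/ rdot (iter n E x) x = rdot (E y) y /\ rdot (E (iter n E x)) x = sqn (E y).
Proof.
have mv m k z : rdot (iter (m + k) E z) z = rdot (iter k E z) (iter m E z).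
  by rewrite iterD (nnpoly_sa _ _ hE saE (nnpoly_pow E m)).
exists (iter n./2 E x); move: (n./2) (odd_double_half n) => m.
rewrite -addnn -iterS; case: (odd n) => <-; [right|left].
- by rewrite add1n -addnS -[(m + m.+1).+1]addSn !mv.
- by rewrite add0n -addnS !mv.
Qed.

Lemma nnpoly_pos F x : nnpoly E F -> 0 <= rdot (F x) x.
Proof.
elim=> [n|{}F G _ hF _ hG|r {}F r0 _ hF].
- have [y [[-> _]|[-> _]]] := iter_split n x; first exact: sqn_ge0.
  exact: le_trans (sqn_ge0 _) (sqE y).
- by rewrite rdotDl addr_ge0.
- by rewrite rdotZl mulr_ge0.
Qed.

(** The inequality E F <= F for a polynomial F in E, that is, positivity of
    (I - E) F. *)
Lemma nnpoly_posE F x : nnpoly E F -> rdot (E (F x)) x <= rdot (F x) x.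
Proof.
elim=> [n|{}F G _ hF _ hG|r {}F r0 _ hF].
- by have [y [[-> ->]|[-> ->]]] := iter_split n x.
- by rewrite bopD// !rdotDl lerD.
- by rewrite bopZ// !rdotZl ler_wpM2l.
Qed.
End Positivity.

Definition half : R[i] := ((2^-1 : R)%:C)%C.

(** The k-th Newton-Schulz iterate for the polar part of A, where B plays the role
    of A^*: X_(k+1) = X_k (I + (I - X_k^* X_k) / 2).  Exchanging A and B in the
    recursion yields the adjoint iterate, so that both are defined at once. *)
Fixpoint ns k A B : H -> H :=
  if k is k'.+1 then
    let X := ns k' A B in let Y := ns k' B A in
    fun x => X x + half *: X (x - Y (X x))
  else A.

Lemma ns_commutant X k A B : X `<=` @bounded_op R H ->
  commutant X A -> commutant X B -> commutant X (ns k A B).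
Proof.
move=> bX; elim: k A B => //= k IH A B cA cB.
have cX := IH _ _ cA cB; have cY := IH _ _ cB cA.
apply: commutant_add => //; apply: commutant_scale => //.
apply: (commutant_comp cX); apply: commutant_sub => //; first exact: commutant_id.
exact: (commutant_comp cY cX).
Qed.

Section Contraction.
Variables A B : H -> H.
Hypothesis hA : bounded_op A.
Hypothesis hB : bounded_op B.
Hypothesis AB : forall x y, rdot (A x) y = rdot x (B y).
Hypothesis cA : forall x, sqn (A x) <= sqn x.

(** The defect I - A^* A; the iterates are A times polynomials in it. *)
Let E x := x - B (A x).

Lemma ns_bop k A' B' : bounded_op A' -> bounded_op B' -> bounded_op (ns k A' B').
Proof.
elim: k A' B' => //= k IH A' B' hA' hB'.
have hX := IH _ _ hA' hB'; have hY := IH _ _ hB' hA'.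
apply: bop_add => //; apply: bop_scale; apply: (@bop_comp _ _ (ns k A' B')) => //.
apply: bop_sub; first exact: bop_id.
by apply: (@bop_comp _ _ (ns k B' A') (ns k A' B')).
Qed.

Lemma ns_adj k x y : rdot (ns k A B x) y = rdot x (ns k B A y).
Proof.
elim: k x y => //= k IH x y.
have hX := ns_bop k hA hB; have hY := ns_bop k hB hA.
rewrite rdotDl rdotDr rdotZl rdotZr !(bopB hX) !(bopB hY) !rdotDl !rdotDr !rdotNl !rdotNr.
have IH' u v : rdot (ns k B A u) v = rdot u (ns k A B v) by rewrite rdotC -IH rdotC.
by rewrite !IH IH' IH.
Qed.

Let hE : bounded_op E.
Proof. by apply: bop_sub; [exact: bop_id|exact: (@bop_comp _ _ B A)]. Qed.

Let BA x y : rdot (B x) y = rdot x (A y).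
Proof. by rewrite rdotC -AB rdotC. Qed.

Let saE x y : rdot (E x) y = rdot x (E y).
Proof. by rewrite /E rdotDl rdotDr rdotNl rdotNr BA AB. Qed.

Lemma contr_adj x : sqn (B x) <= sqn x.
Proof.
have [e0|n0] := eqVneq (sqn (B x)) 0; first by rewrite e0 sqn_ge0.
have np : 0 < sqn (B x) by rewrite lt_neqAle eq_sym n0 sqn_ge0.
rewrite -(ler_pM2l np) -expr2 {1}/sqn BA rdotC.
by rewrite (le_trans (cauchy_schwarz _ _))// ler_wpM2r ?sqn_ge0.
Qed.

Let leE x : rdot (E x) x <= sqn x.
Proof. by rewrite /E rdotDl rdotNl BA; have := sqn_ge0 (A x); rewrite /sqn; lra. Qed.

Let sqE x : sqn (E x) <= rdot (E x) x.
Proof.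
rewrite {1}/E sqnB /E rdotDl rdotNl (rdotC x) !BA.
have := contr_adj (A x); have := cA (B (A x)); rewrite /sqn; lra.
Qed.

(** With E_k = I - X_k^* X_k, the recursion gives
    E_(k+1) = (3/4) E_k^2 + (1/4) E_k^3, so all the E_k, and with them the factors
    I + E_k / 2 of X_(k+1) = X_k (I + E_k / 2), have nonnegative coefficients. *)
Let pE k : (exists2 F, nnpoly E F & forall x, ns k A B x = A (F x)) /\
  nnpoly E (fun x => x - ns k B A (ns k A B x)).
Proof.
elim: k => [|k [[F pF XF] pEk]].
  split; last exact: (nnpoly_pow E 1).
  by exists id => //; exact: (nnpoly_pow E 0).
have hX := ns_bop k hA hB; have hY := ns_bop k hB hA.
set Ek := (fun x => _) in pEk.
have h2 : 0 <= 2^-1 :> R by rewrite invr_ge0.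
have hEk := nnpoly_bop hE pEk.
split.
  exists (fun x => F x + half *: F (Ek x)).
    by apply: nnpoly_add => //; apply: nnpoly_scale => //; exact: nnpoly_comp.
  by move=> x /=; rewrite (bopD hA) (bopZ hA) -!XF.
have -> : (fun x => x - ns k.+1 B A (ns k.+1 A B x)) =
   (fun x => ((3 / 4 : R)%:C)%C *: Ek (Ek x) + ((4^-1 : R)%:C)%C *: Ek (Ek (Ek x))).
  apply/funext => x.
  have step1 z : ns k.+1 B A z = ns k B A z + half *: Ek (ns k B A z).
    by rewrite /= (bopB hY).
  rewrite step1.
  have YX z : ns k B A (ns k A B z) = z - Ek z by rewrite /Ek opprB addrC subrK.
  have step2 : ns k B A (ns k.+1 A B x) = x - Ek x + half *: (Ek x - Ek (Ek x)).
    by rewrite /= (bopD hY) (bopZ hY) -/(Ek x) !YX.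
  rewrite step2; move: (hEk) => /bounded_opP[DE ZE _].
  rewrite !(DE, ZE, bopB hEk, bopN hEk) /half.
  by apply: rdot_ext => z; rewrite !rdotE; field.
have pE2 := nnpoly_comp hE pEk pEk; have pE3 := nnpoly_comp hE pEk pE2.
have h3 : 0 <= 3 / 4 :> R by rewrite divr_ge0.
have h4 : 0 <= 4^-1 :> R by rewrite invr_ge0.
exact: nnpoly_add (nnpoly_scale h3 pE2) (nnpoly_scale h4 pE3).
Qed.

(** Since |x|^2 - |X_k x|^2 = <E_k x, x> and E_k is a nonnegative polynomial. *)
Let contr k x : sqn (ns k A B x) <= sqn x.
Proof.
have := nnpoly_pos hE saE sqE x (pE k).2.
by rewrite rdotDl rdotNl [rdot (ns k B A _) x]rdotC -ns_adj subr_ge0.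
Qed.

(** Here X_k = A F and X_(k+m) = A F + A G with F and G nonnegative polynomials in
    E, so that the cross term 2 <A F x, A G x> = 2 <(I - E) G F x, x> is
    nonnegative. *)
Let incr k m x : sqn (ns (k + m)%N A B x - ns k A B x)
   <= sqn (ns (k + m)%N A B x) - sqn (ns k A B x).
Proof.
have [F [G [pF pG Fk Gk]]] : exists F G, [/\ nnpoly E F, nnpoly E G,
    forall x, ns k A B x = A (F x) & forall x, ns (k + m)%N A B x = A (F x) + A (G x)].
  elim: m => [|m [F [G [pF pG Fk Gk]]]].
    (* The zero polynomial is represented as 0 *: F. *)
    have [[F pF XF] _] := pE k.
    exists F, (fun x => (0%:C)%C *: F x); split=> //.
      exact: nnpoly_scale.
    by move=> z; rewrite addn0 XF scale0r (bop0 hA) addr0.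
  have [Ek pEk step] : exists2 Ek, nnpoly E Ek & forall z,
      ns (k + m).+1 A B z = ns (k + m) A B z + half *: ns (k + m) A B (Ek z).
    by have [_ pEk] := pE (k + m)%N; eexists; first exact: pEk.
  exists F, (fun z => G z + half *: (F (Ek z) + G (Ek z))); split=> //.
    have h2 : 0 <= 2^-1 :> R by rewrite invr_ge0.
    have pFG := nnpoly_add (nnpoly_comp hE pF pEk) (nnpoly_comp hE pG pEk).
    exact: nnpoly_add pG (nnpoly_scale h2 pFG).
  by move=> z; rewrite addnS step !Gk (bopD hA (G z)) (bopZ hA) (bopD hA) addrA.
rewrite Gk Fk [A (F x) + _]addrC addrK sqnD.
have := nnpoly_posE hE saE sqE leE x (nnpoly_comp hE pG pF).
suff -> : rdot (A (G x)) (A (F x)) = rdot (G (F x)) x - rdot (E (G (F x))) x by lra.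
have BAE w : B (A w) = w - E w by rewrite /E opprB addrC subrK.
rewrite rdotC AB BAE rdotDr rdotNr -(nnpoly_commE x hE pG).
by rewrite -!(nnpoly_sa _ _ hE saE pG) -saE -(nnpoly_commE _ hE pG) (nnpoly_sa _ _ hE saE pG).
Qed.

Lemma ns_contr k x : sqn (ns k A B x) <= sqn x. Proof. exact: contr. Qed.

Lemma ns_ge k x : sqn (A x) <= sqn (ns k A B x).
Proof.
have := incr 0 k x; have := sqn_ge0 (ns (0 + k) A B x - ns 0 A B x).
by rewrite add0n /=; lra.
Qed.

Lemma ns_cvg x : exists l, converges (fun k => ns k A B x) l.
Proof.
apply: (@conv_monotone _ _ _ (fun k => sqn (ns k A B x)) (sqn x)) => [n|k m].
  exact: contr.
exact: incr.
Qed.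

Lemma ns_kernel k x : A x = 0 -> ns k A B x = 0.
Proof.
move=> Ax; elim: k => //= k IH.
by rewrite IH add0r (bop0 (ns_bop k hB hA)) subr0 IH scaler0.
Qed.
End Contraction.
End NewtonSchulz.

Section Polar.
Variables (R : realType) (H : hilbert R).
Implicit Types (x y z l : H) (r : R) (A B E F G U W : H -> H).

(** The squared norms of the iterates at x increase from |A x|^2, so the limit
    vanishes only on the kernel of A; conversely all iterates factor through A. *)
Lemma ns_lim A B : bounded_op A -> bounded_op B ->
  (forall x y, rdot (A x) y = rdot x (B y)) -> (forall x, sqn (A x) <= sqn x) ->
  exists U, [/\ bounded_op U, forall x, converges (fun k => ns k A B x) (U x)
    & forall x, U x = 0 <-> A x = 0].
Proof.
move=> hA hB AB cA.
have /choice[U XU] := ns_cvg hA hB AB cA.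
have hX k := ns_bop k hA hB.
exists U; split=> // [|x].
  apply: bop_of_contraction => [x y|c x|x].
  - apply: (conv_unique (XU (x + y))).
    apply: (conv_ext _ (conv_add (XU x) (XU y))) => k; by rewrite (bopD (hX k)).
  - apply: (conv_unique (XU (c *: x))).
    apply: (conv_ext _ (conv_bop (bop_scale c (@bop_id _ H)) (XU x))) => k /=.
    by rewrite (bopZ (hX k)).
  - by apply: (conv_sqn_le (XU x)) => k; exact: ns_contr.
split=> [Ux|Ax].
- apply: sqn_eq0; apply/eqP; rewrite eq_le sqn_ge0 andbT.
  apply/ler_addgt0Pl => e e0; rewrite addr0.
  have [N /(_ N (leqnn N))] := XU x e e0; rewrite Ux subr0 => h.
  by have := ns_ge hA hB AB cA N x; lra.
- apply: (conv_unique (XU x)) => e e0; exists 0%N => n _.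
  by rewrite ns_kernel// subr0 sqn0.
Qed.

(** The partial isometry U of the polar decomposition of a contraction A with
    adjoint B, together with its adjoint W.  The identity U W U = U is the limit
    of the recursion X_(k+1) = (3/2) X_k - (1/2) X_k X_k^* X_k. *)
Theorem polar A B : bounded_op A -> bounded_op B -> is_adjoint A B ->
  (forall x, sqn (A x) <= sqn x) ->
  exists U W, [/\ is_adjoint U W, forall x, U (W (U x)) = U x,
     forall x, U x = 0 <-> A x = 0, forall y, W y = 0 <-> B y = 0 &
     forall X, X `<=` @bounded_op R H -> commutant X A -> commutant X B ->
       commutant X U /\ commutant X W].
Proof.
move=> hA hB adjAB cA; have AB := adj_rdot adjAB.
have BA x y : rdot (B x) y = rdot x (A y) by rewrite rdotC -AB rdotC.
have cB := contr_adj AB cA.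
have [U [hU XU U0]] := ns_lim hA hB AB cA.
have [W [hW YW W0]] := ns_lim hB hA BA cB.
have hX k := ns_bop k hA hB; have hY k := ns_bop k hB hA.
exists U, W; split=> //.
- apply: rdot_adj => // x y.
  have hl := @norm_hausdorff _ R^o.
  rewrite -(cvg_lim hl (conv_rdot (y := y) (XU x))) [RHS]rdotC.
  rewrite -(cvg_lim hl (conv_rdot (y := x) (YW y))); congr (lim (_ @ \oo)).
  by apply/funext => k; rewrite (ns_adj hA hB AB) rdotC.
- move=> x; have cX k x := ns_contr hA hB AB cA k x.
  have cY k x := ns_contr hB hA BA cB k x.
  have h1 := conv_strong hY cY YW (XU x).
  have h2 := conv_strong hX cX XU h1.
  have h3 := conv_bop (bop_scale (- @half R) (@bop_id _ H)) h2.
  have h4 := conv_bop (bop_scale ((3 / 2 : R)%:C)%C (@bop_id _ H)) (XU x).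
  have h5 := conv_add h4 h3.
  have h : U x = ((3 / 2 : R)%:C)%C *: U x + - @half R *: U (W (U x)).
    apply: (conv_unique (conv_shift (XU x))); apply: (conv_ext _ h5) => k /=.
    rewrite (bopB (hX k)) /half; apply: rdot_ext => z.
    by rewrite !scaleNr !rdotE; field.
  apply: rdot_ext => z; have := congr1 (@rdot R H ^~ z) h; rewrite scaleNr /half !rdotE; lra.
- move=> X bX XA XB; split; [apply: commutant_lim hU XU _|apply: commutant_lim hW YW _] => // k;
  exact: ns_commutant.
Qed.
End Polar.

(** * Lattices of closed subspaces and of projections *)

Section LatticeIso.
Variables (R : realType) (H : hilbert R).
Implicit Types (E F G : set H) (P Q : H -> H).

Lemma join_ubl E F : closed_subspace F -> E `<=` subspace_join E F.
Proof.
move=> cF x Ex; apply: subset_closure; exists x => //.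
by exists 0; [exact: csub0|rewrite addr0].
Qed.

Lemma join_ubr E F : closed_subspace E -> F `<=` subspace_join E F.
Proof.
move=> cE x Fx; apply: subset_closure; exists 0; first exact: csub0.
by exists x => //; rewrite add0r.
Qed.

Lemma join_lub E F G : closed_subspace G -> E `<=` G -> F `<=` G -> subspace_join E F `<=` G.
Proof.
move=> cG EG FG; apply: subset_trans (csub_closure cG); apply: closure_subset.
by move=> _ [x Ex [y Fy <-]]; apply: csubD => //; [exact: EG|exact: FG].
Qed.

(** Only the facts that make an order isomorphism preserve the operations: the
    members are closed, and meets and joins of members are members. *)
Record sublattice (L : set (set H)) := Sublattice {
  sub_csub : forall E, L E -> closed_subspace E;
  sub_meet : forall E F, L E -> L F -> L (subspace_meet E F);
  sub_join : forall E F, L E -> L F -> L (subspace_join E F) }.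

(** Monotonicity is asked on all sets, as it holds for images and closures
    without further conditions. *)
Record order_iso (L1 L2 : set (set H)) (f g : set H -> set H) := OrderIso {
  iso_f : forall E, L1 E -> L2 (f E);
  iso_g : forall E, L2 E -> L1 (g E);
  iso_fhomo : forall E F, E `<=` F -> f E `<=` f F;
  iso_ghomo : forall E F, E `<=` F -> g E `<=` g F;
  iso_gf : forall E, L1 E -> g (f E) = E;
  iso_fg : forall E, L2 E -> f (g E) = E }.

Section OrderIso.
Variables (L1 L2 : set (set H)) (f g : set H -> set H).
Hypotheses (sL1 : sublattice L1) (sL2 : sublattice L2) (fg : order_iso L1 L2 f g).

(** Meets are greatest lower bounds and joins are least upper bounds, hence both
    are determined by the order. *)
Lemma order_iso_meet E F : L1 E -> L1 F ->
  f (subspace_meet E F) = subspace_meet (f E) (f F).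
Proof.
move=> LE LF; apply/seteqP; split.
  by rewrite subsetI; split; apply: (iso_fhomo fg) => x [].
have LfEF := sub_meet sL2 (iso_f fg LE) (iso_f fg LF).
rewrite -[X in X `<=` _](iso_fg fg LfEF); apply: (iso_fhomo fg).
rewrite subsetI; split.
  by rewrite -[X in _ `<=` X](iso_gf fg LE); apply: (iso_ghomo fg) => x [].
by rewrite -[X in _ `<=` X](iso_gf fg LF); apply: (iso_ghomo fg) => x [].
Qed.

Lemma order_iso_join E F : L1 E -> L1 F ->
  f (subspace_join E F) = subspace_join (f E) (f F).
Proof.
move=> LE LF; have LfE := iso_f fg LE; have LfF := iso_f fg LF.
have cE := sub_csub sL1 LE; have cF := sub_csub sL1 LF.
have cfE := sub_csub sL2 LfE; have cfF := sub_csub sL2 LfF.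
have LJ := sub_join sL2 LfE LfF; apply/seteqP; split; last first.
  apply: join_lub; first exact: sub_csub sL2 _ (iso_f fg (sub_join sL1 LE LF)).
    by apply: (iso_fhomo fg); exact: join_ubl.
  by apply: (iso_fhomo fg); exact: join_ubr.
rewrite -[X in _ `<=` X](iso_fg fg LJ); apply: (iso_fhomo fg).
apply: join_lub; first exact: sub_csub sL1 _ (iso_g fg LJ).
  by rewrite -[X in X `<=` _](iso_gf fg LE); apply: (iso_ghomo fg); exact: join_ubl.
by rewrite -[X in X `<=` _](iso_gf fg LF); apply: (iso_ghomo fg); exact: join_ubr.
Qed.

Lemma lattice_iso_subspaces :
  lattice_isomorphic L1 (@subspace_meet R H) (@subspace_join R H)
                     L2 (@subspace_meet R H) (@subspace_join R H).
Proof.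
exists f; split; last first.
  by move=> E F LE LF; rewrite order_iso_meet// order_iso_join.
split; first exact: iso_f fg.
  move=> E F /set_mem LE /set_mem LF e.
  by rewrite -(iso_gf fg LE) e (iso_gf fg LF).
by move=> F LF; exists (g F); [exact: iso_g fg _ LF|exact: iso_fg fg _ LF].
Qed.

(** Closed subspaces and the projections onto them determine each other, so an
    isomorphism of subspace lattices induces one of projection lattices. *)
Lemma lattice_iso_projs :
  lattice_isomorphic
    [set P | projection P /\ L1 (range P)] (@proj_meet R H) (@proj_join R H)
    [set P | projection P /\ L2 (range P)] (@proj_meet R H) (@proj_join R H).
Proof.
have onto1 E : L1 E -> projection (proj_onto E) /\ range (proj_onto E) = E.
  by move=> /(sub_csub sL1)/proj_ontoP.
have onto2 E : L2 E -> projection (proj_onto E) /\ range (proj_onto E) = E.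
  by move=> /(sub_csub sL2)/proj_ontoP.
exists (fun P => proj_onto (f (range P))); split; last first.
  move=> P Q [hP LP] [hQ LQ]; rewrite /proj_meet /proj_join.
  have [_ ->] := onto1 _ (sub_meet sL1 LP LQ).
  have [_ ->] := onto1 _ (sub_join sL1 LP LQ).
  have [_ ->] := onto2 _ (iso_f fg LP).
  have [_ ->] := onto2 _ (iso_f fg LQ).
  by rewrite order_iso_meet// order_iso_join.
split.
- move=> P [hP LP] /=; have LfP := iso_f fg LP.
  by have [h ->] := onto2 _ LfP.
- move=> P Q /set_mem[hP LP] /set_mem[hQ LQ] /(congr1 (fun P => range P)).
  have [_ ->] := onto2 _ (iso_f fg LP); have [_ ->] := onto2 _ (iso_f fg LQ).
  by move=> /(congr1 g); rewrite !(iso_gf fg)//; exact: proj_unique.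
- move=> Q [hQ LQ]; have [h1 h2] := onto1 _ (iso_g fg LQ).
  exists (proj_onto (g (range Q))); first by rewrite /= h2; split=> //; exact: iso_g fg _ LQ.
  by rewrite h2 (iso_fg fg LQ) proj_onto_range.
Qed.
End OrderIso.
End LatticeIso.

(** * Invariant subspaces relative to a von Neumann algebra *)

Section VonNeumann.
Variables (R : realType) (H : hilbert R) (M : set (H -> H)).
Hypothesis vM : von_neumann_algebra M.
Implicit Types (A B C P Q S T : H -> H) (E F : set H).

Lemma vna_bop A : M A -> bounded_op A.
Proof. by case: vM => bM _ _ /bM. Qed.

Lemma vna_bicommutant : commutant (commutant M) = M.
Proof. by case: vM. Qed.

Lemma commutant_bop : commutant M `<=` @bounded_op R H.
Proof. by move=> B []. Qed.

Lemma vna_id : M id.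
Proof. by rewrite -vna_bicommutant; exact: commutant_id. Qed.

Lemma vna_comp A B : M A -> M B -> M (A \o B).
Proof. by rewrite -vna_bicommutant; exact: commutant_comp. Qed.

Lemma vna_add A B : M A -> M B -> M (fun x => A x + B x).
Proof. by rewrite -vna_bicommutant; apply: commutant_add; exact: commutant_bop. Qed.

Lemma vna_sub A B : M A -> M B -> M (fun x => A x - B x).
Proof. by rewrite -vna_bicommutant; apply: commutant_sub; exact: commutant_bop. Qed.

Lemma vna_scale A c : M A -> M (fun x => c *: A x).
Proof. by rewrite -vna_bicommutant; apply: commutant_scale; exact: commutant_bop. Qed.

Lemma vna_comm A B : M A -> commutant M B -> forall x, B (A x) = A (B x).
Proof. by move=> MA /commutantP[_ cB] x; rewrite cB. Qed.

Lemma proj_id : projection (id : H -> H).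
Proof. by split=> //; exact: bop_id. Qed.

Lemma proj_0 : projection ((fun=> 0) : H -> H).
Proof.
split=> //; last by move=> x y; rewrite linear0l linear0r.
by apply: bop_of_contraction => [x y|c x|x]; rewrite ?addr0 ?scaler0// sqn0 sqn_ge0.
Qed.

Lemma vna_0 : M (fun=> 0).
Proof.
have -> : (fun=> 0) = (fun x : H => x - x) by apply/funext => x; rewrite subrr.
by apply: vna_sub; exact: vna_id.
Qed.

(** The ranges of the projections of M, described without projections: invariance
    under the commutant of M characterizes them ([affiliated_proj],
    [affiliated_range]) and is visibly preserved by intersections, closed sums,
    kernels and closed images under M. *)
Definition affiliated E :=
  closed_subspace E /\ forall B, commutant M B -> B @` E `<=` E.

Lemma commutant_adj B C : commutant M B -> bounded_op C -> is_adjoint B C -> commutant M C.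
Proof.
move=> cB hC adjBC; apply/commutantP; split=> // A x MA.
have [_ /(_ A MA)[A' MA' adjA] _] := vM.
apply: rdot_ext => z; rewrite (adj_rdot adjA) (adj_rdot_sym adjBC).
by rewrite (adj_rdot_sym adjBC) (vna_comm MA' cB) (adj_rdot adjA).
Qed.

(** The commutant of M is stable under adjoints, so both B and B^* preserve E;
    thus P B P = B P and P B^* P = B^* P, and the adjoint of the latter gives
    P B = P B P = B P.  The bicommutant is M. *)
Lemma affiliated_proj E : affiliated E -> M (proj_onto E).
Proof.
move=> [cE iE]; have [hP rP] := proj_ontoP cE; set P := proj_onto E in hP rP *.
have PE x : E (P x) by rewrite -rP; exists x.
have EP x : E x -> P x = x by rewrite -rP; move/(proj_rangeP hP).
have PBP B : commutant M B -> forall x, P (B (P x)) = B (P x).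
  by move=> cB x; apply: EP; apply: iE cB _ _; exists (P x).
rewrite -vna_bicommutant; apply/commutantP; split; first exact: proj_bop.
move=> B x cB; have [C hC adjBC] := adjoint_exists (commutant_bop cB).
have cC := commutant_adj cB hC adjBC.
apply: rdot_ext => y.
rewrite -(PBP _ cB) (proj_sa hP) (adj_rdot adjBC) (proj_sa hP) (PBP _ cC).
by rewrite -(adj_rdot adjBC) -(proj_sa hP).
Qed.

Lemma affiliated_range P : M P -> projection P -> affiliated (range P).
Proof.
move=> MP hP; split; first exact: csub_range.
by move=> B cB _ [_ [x _ <-] <-]; exists (B x) => //; rewrite (vna_comm MP cB).
Qed.

Lemma affiliated_meet E F : affiliated E -> affiliated F -> affiliated (subspace_meet E F).
Proof.
move=> [cE iE] [cF iF]; split; first exact: csub_setI.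
move=> B cB _ [x [Ex Fx] <-]; split; [apply: iE cB _ _|apply: iF cB _ _]; by exists x.
Qed.

Lemma bop_join B E F : bounded_op B -> B @` E `<=` E -> B @` F `<=` F ->
  B @` subspace_join E F `<=` subspace_join E F.
Proof.
move=> hB BE BF; apply: bop_closure => // _ [_ [x Ex [y Fy <-]] <-].
exists (B x); first by apply: BE; exists x.
by exists (B y); [apply: BF; exists y|rewrite bopD].
Qed.

Lemma affiliated_join E F : affiliated E -> affiliated F -> affiliated (subspace_join E F).
Proof.
move=> [cE iE] [cF iF]; split; first exact: csub_join.
by move=> B cB; apply: bop_join; [case: cB|exact: iE|exact: iF].
Qed.

Lemma affiliated_image A E : M A -> affiliated E -> affiliated (closure (A @` E)).
Proof.
move=> MA [cE iE]; split; first by apply: csub_closure_image => //; exact: vna_bop.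
move=> B cB; apply: bop_closure; first by case: cB.
move=> _ [_ [x Ex <-] <-]; exists (B x); first by apply: iE cB _ _; exists x.
by rewrite (vna_comm MA cB).
Qed.

Lemma affiliated_kernel A : M A -> affiliated (null_space A).
Proof.
move=> MA; split; first by apply: csub_kernel; exact: vna_bop.
move=> B cB _ [x Ax <-]; rewrite /null_space /= -(vna_comm MA cB) Ax bop0//.
by case: cB.
Qed.

Lemma affiliated_setT : affiliated setT.
Proof. by split; first exact: csub_setT. Qed.

(** The lattice of A relative to M, seen on ranges of projections ([latE]). *)
Definition inv_lat A : set (set H) := [set E | affiliated E /\ A @` E `<=` E].

Lemma inv_lat_sublattice A : bounded_op A -> sublattice (inv_lat A).
Proof.
move=> hA; split=> [E [[]]//|E F [aE iE] [aF iF]|E F [aE iE] [aF iF]].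
- split; first exact: affiliated_meet.
  by move=> _ [x [Ex Fx] <-]; split; [apply: iE|apply: iF]; exists x.
- by split; [exact: affiliated_join|exact: bop_join].
Qed.

Lemma latE A : lat M A = [set P | projection P /\ inv_lat A (range P)].
Proof.
apply/seteqP; split=> P.
- move=> [[MP hP] AP]; split=> //; split; first exact: affiliated_range.
  move=> _ [_ [x _ <-] <-]; exists (A (P x)) => //.
  by have := congr1 (@^~ x) AP => /= <-.
- move=> [hP [aP iP]]; split; last first.
    apply/funext => x /=; apply/esym/(proj_rangeP hP); apply: iP.
    by exists (P x) => //; exists x.
  by split=> //; have := affiliated_proj aP; rewrite proj_onto_range.
Qed.

Lemma lat_0 A : bounded_op A -> lat M A (fun=> 0).
Proof.
move=> hA; split; first by split; [exact: vna_0|exact: proj_0].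
by apply/funext => x /=; rewrite bop0.
Qed.

Lemma lat_id A : lat M A id.
Proof. by split; first by split; [exact: vna_id|exact: proj_id]. Qed.

Lemma trivial_latP A : bounded_op A ->
  trivial_lat (lat M A) <-> forall E, inv_lat A E -> E = [set 0] \/ E = setT.
Proof.
move=> hA; have r0 : range ((fun=> 0) : H -> H) = [set 0].
  by apply/seteqP; split=> [_ [x _ <-]//|_ ->]; exists 0.
have r1 : range (id : H -> H) = setT by apply/seteqP; split=> // x _; exists x.
split=> [tA E LE|tA].
- have [hP rP] : projection (proj_onto E) /\ range (proj_onto E) = E.
    by apply: proj_ontoP; case: LE => [[]].
  have : lat M A (proj_onto E) by rewrite latE /= rP.
  by rewrite tA => -[/= e|/= e]; [left|right]; rewrite -rP e.
- apply/seteqP; split=> [P|_ [->|->]]; [|exact: lat_0|exact: lat_id].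
  rewrite latE => -[hP /tA[] e]; [left|right].
    by apply: proj_unique => //; [exact: proj_0|rewrite r0].
  by apply: proj_unique => //; [exact: proj_id|rewrite r1].
Qed.

(** The commutant of A contains that of M, as A is in M, and it contains A. *)
Lemma hyper_inv_lat A : M A -> hyperinvariant A `<=` inv_lat A.
Proof.
move=> MA E [cE iE]; split; last first.
  apply: iE; split; first exact: vna_bop.
  by move=> _ ->.
split=> // B cB; apply: iE; split; first by case: cB.
by move=> _ ->; apply/funext => x /=; rewrite (vna_comm MA cB).
Qed.

Lemma hyper_sublattice A : sublattice (hyperinvariant A).
Proof.
split=> [E []//|E F [cE iE] [cF iF]|E F [cE iE] [cF iF]].
- split; first exact: csub_setI.
  move=> B cB _ [x [Ex Fx] <-]; split; [apply: iE cB _ _|apply: iF cB _ _]; by exists x.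
- split; first exact: csub_join.
  by move=> B cB; apply: bop_join; [case: cB|exact: iE|exact: iF].
Qed.

(** * Finite von Neumann algebras *)

Section Finite.
Hypothesis fM : finite_proj M id.

(** For an injective contraction A, the polar part U is an isometry of M, so the
    identity is equivalent to U U^*.  Finiteness forces U U^* = I, hence W = U^*,
    which has the kernel of B, is injective. *)
Lemma finite_injective_adjoint A B : M A -> M B -> is_adjoint A B ->
  (forall x, A x = 0 -> x = 0) -> forall y, B y = 0 -> y = 0.
Proof.
move=> MA MB adjAB A0.
have [K K0 bK] := bop_bound (vna_bop MA).
(* A factor making A a contraction: c^2 K <= 1. *)
pose c := (((1 + K)^-1)%:C)%C : R[i].
have K1 : 0 < 1 + K by rewrite addr_gt0.
have c0 : c != 0 by rewrite /c fmorph_eq0 invr_eq0 gt_eqF.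
have cZ x : c *: x = 0 -> x = 0 
  by move=> e; rewrite -(scale1r x) -(mulVf c0) -scalerA e scaler0.
pose A1 := fun x => c *: A x; pose B1 := fun x => c *: B x.
have MA1 : M A1 by exact: vna_scale. 
have MB1 : M B1 by exact: vna_scale.
have adj1 : is_adjoint A1 B1.
  apply: rdot_adj; first exact: vna_bop.
  by move=> x y; rewrite rdotZl rdotZr (adj_rdot adjAB).
have c1 x : sqn (A1 x) <= sqn x.
  rewrite /A1 sqnZ exprVn mulrC ler_pdivrMr ?exprn_gt0//.
  rewrite (le_trans (bK x))// mulrC ler_wpM2l ?sqn_ge0//; nra.
have [U [W [adjUW UWU U0 W0 cUW]]] := polar (vna_bop MA1) (vna_bop MB1) adj1 c1.
have [MU MW] : M U /\ M W.
  rewrite -vna_bicommutant; apply: cUW; first exact: commutant_bop.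
    by rewrite vna_bicommutant.
  by rewrite vna_bicommutant.
have WU x : W (U x) = x.
  apply/eqP; rewrite -subr_eq0; apply/eqP/A0/cZ/U0.
  by rewrite (bopB (vna_bop MU)) UWU subrr.
have UWid : U \o W = id.
  apply: fM.2.
  - split; first exact: vna_comp.
    split; first by apply: vna_bop; exact: vna_comp.
      by apply/funext => x /=; rewrite WU.
    apply: rdot_adj => [|x y /=]; first by apply: vna_bop; exact: vna_comp.
    by rewrite (adj_rdot adjUW) (adj_rdot_sym adjUW).
  - by [].
  - by exists U, W; split=> //; apply/funext => x /=; rewrite WU.
move=> y By; have /W0 Wy : B1 y = 0 by rewrite /B1 By scaler0.
have := congr1 (@^~ y) UWid; rewrite /= Wy => <-.
exact: bop0 (vna_bop MU).
Qed.

Lemma finite_dense_range A : M A -> (forall x, A x = 0 -> x = 0) -> closure (range A) = setT.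
Proof.
move=> MA A0; have [_ /(_ A MA)[B MB adjAB] _] := vM.
apply: dense_of_ortho.
  by apply: csub_closure_image; [exact: vna_bop|exact: csub_setT].
move=> z hz; apply: (finite_injective_adjoint MA MB adjAB A0).
apply: rdot_ext => x; rewrite (adj_rdot_sym adjAB) rdot0l; apply: hz.
by apply: subset_closure; exists x.
Qed.

(** On E the operator A may be replaced by A' = A P + (I - P), which belongs to M,
    is injective because A is, and maps the complement of E identically: the
    density of its range in the whole space gives that of A E in E. *)
Lemma finite_dense_image A E : M A -> (forall x, A x = 0 -> x = 0) ->
  inv_lat A E -> closure (A @` E) = E.
Proof.
move=> MA A0 [aE iE]; have [cE _] := aE.
have [hP rP] := proj_ontoP cE; have MP := affiliated_proj aE.
set P := proj_onto E in hP rP MP.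
have PE x : E (P x) by rewrite -rP; exists x.
have EP x : E x -> P x = x by rewrite -rP; move/(proj_rangeP hP).
have PAP x : P (A (P x)) = A (P x) by apply: EP; apply: iE; exists (P x).
apply/seteqP; split.
  by apply: subset_trans (csub_closure cE); exact: closure_subset.
pose A' := fun x => A (P x) + (x - P x).
have MA' : M A'.
  by apply: vna_add; [exact: (vna_comp MA MP)|exact: vna_sub vna_id MP].
have hPb := proj_bop hP.
have PA' x : P (A' x) = A (P x).
  by rewrite /A' (bopD hPb) (bopB hPb) PAP proj_idem// subrr addr0.
have A'0 x : A' x = 0 -> x = 0.
  move=> e; have Px : P x = 0 by apply: A0; rewrite -PA' e (bop0 hPb).
  by move: e; rewrite /A' Px (bop0 (vna_bop MA)) subr0 add0r.
move=> y Ey; rewrite -(EP _ Ey).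
have : (P @` closure (range A')) (P y).
  by exists y => //; rewrite (finite_dense_range MA' A'0).
apply: bop_closure => // _ [_ [x _ <-] <-]; rewrite PA'.
by exists (P x).
Qed.

Lemma image_round_trip S T E : M S -> M T ->
  (forall x, S x = 0 -> x = 0) -> (forall x, T x = 0 -> x = 0) ->
  inv_lat (S \o T) E -> closure (S @` closure (T @` E)) = E.
Proof.
move=> MS MT S0 T0 LE.
have ST0 x : (S \o T) x = 0 -> x = 0 by move=> /S0/T0.
have e := finite_dense_image (vna_comp MS MT) ST0 LE.
apply/seteqP; split.
- have [[cE _] iE] := LE; have sE := csub_closure cE.
  apply: subset_trans (sE); apply: closure_subset; apply: subset_trans (sE).
  apply: bop_closure; first exact: vna_bop.
  by move=> _ [_ [x Ex <-] <-]; apply: iE; exists x.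
- rewrite -[X in X `<=` _]e; apply: closure_subset => _ [x Ex <-].
  by exists (T x) => //; apply: subset_closure; exists x.
Qed.

Lemma inv_lat_image S T E : M S -> M T ->
  inv_lat (S \o T) E -> inv_lat (T \o S) (closure (T @` E)).
Proof.
move=> MS MT [aE iE]; split; first exact: affiliated_image.
apply: bop_closure; first by apply: bop_comp; exact: vna_bop.
by move=> _ [_ [x Ex <-] <-]; exists (S (T x)) => //; apply: iE; exists x.
Qed.

(** For B in the commutant of T S, the operator S B T commutes with S T, hence
    B T (S T x) = T (S B T x) lies in T E for x in E; density of S T E in E
    extends this from S T E to E. *)
Lemma hyper_image S T E : M S -> M T ->
  (forall x, S x = 0 -> x = 0) -> (forall x, T x = 0 -> x = 0) ->
  hyperinvariant (S \o T) E -> hyperinvariant (T \o S) (closure (T @` E)).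
Proof.
move=> MS MT S0 T0 hE; have [cE iE] := hE.
have hS := vna_bop MS; have hT := vna_bop MT.
split; first exact: csub_closure_image.
move=> B cB; have hB : bounded_op B by case: cB.
have BTS x : B (T (S x)) = T (S (B x)).
  by have [_ /(_ _ erefl) e] := cB; exact/esym/(congr1 (@^~ x) e).
have SBT : S @` (B @` (T @` E)) `<=` E.
  have cSBT : commutant [set S \o T] (S \o B \o T).
    split; first by apply: bop_comp => //; exact: bop_comp.
    by move=> _ ->; apply/funext => x /=; rewrite -BTS.
  by move=> _ [_ [_ [x Ex <-] <-] <-]; apply: iE cSBT _ _; exists x.
have ST0 x : (S \o T) x = 0 -> x = 0 by move=> /S0/T0.
have e := finite_dense_image (vna_comp MS MT) ST0 (hyper_inv_lat (vna_comp MS MT) hE).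
have BT : (B \o T) @` E `<=` closure (T @` E).
  rewrite -{1}e; apply: bop_closure; first exact: bop_comp.
  move=> _ [_ [x Ex <-] <-] /=; rewrite BTS; exists (S (B (T x))) => //.
  by apply: SBT; exists (B (T x)) => //; exists (T x) => //; exists x.
apply: subset_trans (csub_closure (csub_closure_image hT cE)).
apply: bop_closure => // _ [_ [x Ex <-] <-].
by apply: BT; exists x.
Qed.

Lemma inv_lat_iso S T : M S -> M T ->
  (forall x, S x = 0 -> x = 0) -> (forall x, T x = 0 -> x = 0) ->
  order_iso (inv_lat (S \o T)) (inv_lat (T \o S))
    (fun E => closure (T @` E)) (fun E => closure (S @` E)).
Proof.
move=> MS MT S0 T0; split=> [E|E|E F EF|E F EF|E|E].
- exact: inv_lat_image.
- exact: inv_lat_image.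
- exact/closure_subset/image_subset.
- exact/closure_subset/image_subset.
- exact: image_round_trip.
- exact: image_round_trip.
Qed.

Lemma hyper_iso S T : M S -> M T ->
  (forall x, S x = 0 -> x = 0) -> (forall x, T x = 0 -> x = 0) ->
  order_iso (hyperinvariant (S \o T)) (hyperinvariant (T \o S))
    (fun E => closure (T @` E)) (fun E => closure (S @` E)).
Proof.
move=> MS MT S0 T0; have iso := inv_lat_iso MS MT S0 T0.
split=> [E|E|E F|E F|E|E].
- exact: hyper_image.
- exact: hyper_image.
- exact: iso_fhomo iso _ _.
- exact: iso_ghomo iso _ _.
- by move=> /hyper_inv_lat hE; apply: (iso_gf iso); apply: hE; exact: vna_comp.
- by move=> /hyper_inv_lat hE; apply: (iso_fg iso); apply: hE; exact: vna_comp.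
Qed.

Lemma trivial_transfer S T : M S -> M T ->
  (forall x, S x = 0 -> x = 0) -> (forall x, T x = 0 -> x = 0) ->
  trivial_lat (lat M (S \o T)) -> trivial_lat (lat M (T \o S)).
Proof.
move=> MS MT S0 T0.
move=> /(trivial_latP (vna_bop (vna_comp MS MT))) tST.
apply/(trivial_latP (vna_bop (vna_comp MT MS))) => F LF.
have iso := inv_lat_iso MS MT S0 T0; rewrite -(iso_fg iso LF).
have [->|->] := tST _ (iso_g iso LF); [left|right].
- rewrite image_set1 (bop0 (vna_bop MT)); apply/esym/closure_id.
  by case: (@csub_set0 _ H).
- exact: finite_dense_range.
Qed.

(** * Products with a kernel *)

Section Singular.
Hypothesis noatom : forall P, ~ minimal_proj M P.
Hypothesis nonzero : exists x : H, x != 0.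

(** Every projection of M is invariant under 0, and the identity, not being
    minimal, dominates one other than 0 and itself. *)
Lemma nontrivial_zero : ~ trivial_lat (lat M (fun=> 0)).
Proof.
move=> t0; apply: (noatom (P := id)); split; first exact: fM.1.
  by have [x x0] := nonzero; move=> /(congr1 (@^~ x)) /= e; rewrite e eqxx in x0.
move=> Q [MQ hQ] _; have : lat M (fun=> 0) Q.
  by split=> //; apply/funext => x /=; rewrite (bop0 (proj_bop hQ)).
by rewrite t0.
Qed.

(** If the kernel of A is the whole space, then A = 0. *)
Lemma nontrivial_kernel A x : M A -> x != 0 -> A x = 0 -> ~ trivial_lat (lat M A).
Proof.
move=> MA x0 Ax tA.
have hA := vna_bop MA.
have LA : inv_lat A (null_space A).
  split; first exact: affiliated_kernel.
  by move=> _ [y Ay <-]; rewrite /null_space /= Ay bop0.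
have [N0|NT] := (trivial_latP hA).1 tA _ LA.
  by have : null_space A x by []; rewrite N0 => /= e; rewrite e eqxx in x0.
apply: nontrivial_zero; rewrite -[X in trivial_lat (lat M X)](_ : A = _)//.
by apply/funext => y; have : null_space A y by rewrite NT.
Qed.

(** The closed range of A misses y, since y is orthogonal to it; if it is zero,
    then A = 0. *)
Lemma nontrivial_range A y : M A -> y != 0 -> (forall x, rdot (A x) y = 0) ->
  ~ trivial_lat (lat M A).
Proof.
move=> MA y0 Ay tA.
have hA := vna_bop MA.
have LA : inv_lat A (closure (range A)).
  split; first exact/affiliated_image/affiliated_setT.
  by apply: bop_closure => // _ [x _ <-]; exists x.
have [N0|NT] := (trivial_latP hA).1 tA _ LA.
  apply: nontrivial_zero; rewrite -[X in trivial_lat (lat M X)](_ : A = _)//.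
  apply/funext => x; have : closure (range A) (A x) by apply: subset_closure; exists x.
  by rewrite N0.
have : closure (range A) y by rewrite NT.
move=> /closure_sqnP /(_ (sqn y))[].
  by rewrite lt_neqAle sqn_ge0 andbT eq_sym; apply: contraNneq y0 => /sqn_eq0 ->.
move=> _ [x _ <-]; rewrite sqnB rdotC Ay; have := sqn_ge0 (A x); lra.
Qed.

(** The kernel of S is contained in that of T S.  By finiteness the adjoint of S
    annihilates some nonzero y, which is then orthogonal to the range of S T. *)
Lemma nontrivial_singular S T x : M S -> M T -> x != 0 -> S x = 0 ->
  ~ trivial_lat (lat M (S \o T)) /\ ~ trivial_lat (lat M (T \o S)).
Proof.
move=> MS MT x0 Sx; split; last first.
  by apply: nontrivial_kernel x0 _; [exact: vna_comp|rewrite /= Sx (bop0 (vna_bop MT))].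
have [_ /(_ S MS)[B MB adjSB] _] := vM.
have [y [y0 By]] : exists y, y != 0 /\ B y = 0.
  apply/not_existsP => h.
  have B0 y : B y = 0 -> y = 0.
    by move=> By; apply/eqP/negP => /negP y0; apply: (h y).
  have adjBS : is_adjoint B S by apply: rdot_adj (vna_bop MS) (adj_rdot_sym adjSB).
  by have := finite_injective_adjoint MB MS adjBS B0 Sx => e; rewrite e eqxx in x0.
apply: (nontrivial_range (vna_comp MS MT) y0) => z.
by rewrite (adj_rdot adjSB) By rdot0r.
Qed.
End Singular.
End Finite.
End VonNeumann.

Theorem corollary5p6 (R : realType) (H : hilbert R) (M : set (H -> H))
    (S T : H -> H) (hM : type_II1_factor M) (hS : M S) (hT : M T) :
  (~ trivial_lat (lat M (S \o T)) <-> ~ trivial_lat (lat M (T \o S))) /\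
  (null_space S = [set 0] -> null_space T = [set 0] ->
     lattice_isomorphic
       (lat M (S \o T)) (@proj_meet R H) (@proj_join R H)
       (lat M (T \o S)) (@proj_meet R H) (@proj_join R H) /\
     lattice_isomorphic
       (hyperinvariant (S \o T)) (@subspace_meet R H) (@subspace_join R H)
       (hyperinvariant (T \o S)) (@subspace_meet R H) (@subspace_join R H)).
Proof.
have [[vM nonzero _] fM noatom] := hM.
have inj (A : H -> H) : null_space A = [set 0] -> forall x, A x = 0 -> x = 0.
  by move=> A0 x Ax; have : null_space A x by []; rewrite A0.
split; last first.
  move=> /inj S0 /inj T0; split.
    rewrite !latE//; apply: lattice_iso_projs (inv_lat_iso vM fM hS hT S0 T0);
    by apply: inv_lat_sublattice => //; apply: (vna_bop vM); exact: vna_comp.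
  apply: lattice_iso_subspaces (hyper_iso vM fM hS hT S0 T0); exact: hyper_sublattice.
have inj_or (A : H -> H) : (forall x, A x = 0 -> x = 0) \/ exists x, x != 0 /\ A x = 0.
  have [h|h] := pselect (exists x, x != 0 /\ A x = 0); [by right|left] => x Ax.
  by apply/eqP/negP => /negP x0; apply: h; exists x.
have [S0|[x [x0 Sx]]] := inj_or S; last first.
  by have [] := nontrivial_singular vM fM noatom nonzero hS hT x0 Sx.
have [T0|[x [x0 Tx]]] := inj_or T; last first.
  by have [] := nontrivial_singular vM fM noatom nonzero hT hS x0 Tx.
by split; apply: contra_not; exact: trivial_transfer.
Qed.
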